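(* Let $n=1$, let $\psi:\mathbb{R}\to[0,\infty)$ be a smooth, even, compactly supported function with $\|\psi\|_{L^\infty}\le1$, and let $d\sigma_{loc}=\psi(\nu)\,d\sigma$ be the associated localized surface measure on $S=\{(\alpha,\lambda,\nu)\in\mathbb{N}_0\times\mathbb{R}^*\times\mathbb{R}:\nu=(2\alpha+1)|\lambda|\}$. If $1\le q\le2$, then there is a constant $C(q)$ such that $$\|\mathcal{R}_{S_{loc}}f\|_{L^2(S,d\sigma_{loc})}\le C(q)\,\|f\|_{L_t^1L_s^qL_x^2}$$ for all functions $f\in\mathcal{S}(\mathbb{R}^{3})$.
   Context: Points of $\mathbb{R}^3$ are $(x,t,s)$ with $x,t,s\in\mathbb{R}$; $\mathcal{S}$ is the Schwartz class; $\mathbb{R}^*=\mathbb{R}\setminus\{0\}$. Hermite functions: for $\alpha\in\mathbb{N}_0$, $\Phi_\alpha(x)=(2^\alpha\sqrt{\pi}\,\alpha!)^{-1/2}H_\alpha(x)e^{-x^2/2}$ with $H_\alpha(x)=(-1)^\alpha e^{x^2}\frac{d^\alpha}{dx^\alpha}e^{-x^2}$; for $\lambda\in\mathbb{R}^*$, $\Phi_\alpha^\lambda(x)=|\lambda|^{1/4}\Phi_\alpha(\sqrt{|\lambda|}\,x)$. Scaled Hermite-Fourier transform: $\hat f(\alpha,\lambda,\nu)=\int_{\mathbb{R}}\int_{\mathbb{R}}\int_{\mathbb{R}}e^{i\lambda t}e^{i\nu s}f(x,t,s)\Phi_\alpha^\lambda(x)\,ds\,dt\,dx$ for $(\alpha,\lambda,\nu)\in\mathbb{N}_0\times\mathbb{R}^*\times\mathbb{R}$.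 Measure: $\int_S\Theta\,d\sigma_{loc}=\sum_{\alpha\in\mathbb{N}_0}\int_{\mathbb{R}^*}\Theta(\alpha,\lambda,(2\alpha+1)|\lambda|)\,\psi((2\alpha+1)|\lambda|)\,d\lambda$. Restriction operator: $\mathcal{R}_{S_{loc}}f=\hat f|_S$. Mixed norm: $\|f\|_{L_t^1L_s^qL_x^2}=\int_{\mathbb{R}}\Big(\int_{\mathbb{R}}\Big(\int_{\mathbb{R}}|f(x,t,s)|^2\,dx\Big)^{q/2}ds\Big)^{1/q}dt$. The cutoff $\psi$ is fixed; constants may depend on it. *)

(* Defs.v *)
From HB Require Import structures.
From mathcomp Require Export all_boot all_order all_algebra.
From mathcomp Require Export all_classical all_reals all_analysis.
From mathcomp Require Export complex.

Set Implicit Arguments.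
Unset Strict Implicit.
Unset Printing Implicit Defensive.

Import Order.TTheory GRing.Theory Num.Theory.
Import numFieldNormedType.Exports.

Local Open Scope classical_set_scope.
Local Open Scope ring_scope.

Section defs.
Context {R : realType}.

Local Notation mu := (@lebesgue_measure R).
Local Notation R3 := (R * R * R)%type.

Definition cmod (z : R[i]) : R := Normc.normc z.

Definition cexpi (y : R) : R[i] := Complex (cos y) (sin y).

Definition cintegral (g : R -> R[i]) : R[i] :=
  Complex (\int[mu]_x complex.Re (g x)) (\int[mu]_x complex.Im (g x)).

Definition smooth1 (g : R -> R) : Prop :=
  forall n x, derivable (derive1n n g) x 1.

(* The empty word gives g itself.  Differentiability (in the sense of Frechet)
   of all iterated directional derivatives is the C^oo property. *)
Definition smooth3 (g : R3 -> R) : Prop :=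
  forall (w : seq R3) (p : R3), differentiable (foldr (fun v h => 'D_v h) g w) p.

Definition partial3 (b : nat * nat * nat) (g : R3 -> R) : R3 -> R :=
  iter b.1.1 (fun h => 'D_((1, 0, 0) : R3) h)
    (iter b.1.2 (fun h => 'D_((0, 1, 0) : R3) h)
      (iter b.2 (fun h => 'D_((0, 0, 1) : R3) h) g)).

Definition monomial3 (a : nat * nat * nat) (p : R3) : R :=
  p.1.1 ^+ a.1.1 * p.1.2 ^+ a.1.2 * p.2 ^+ a.2.

Definition schwartz_real (g : R3 -> R) : Prop :=
  smooth3 g /\
  forall a b : nat * nat * nat, exists M : R, forall p : R3,
    `|monomial3 a p * partial3 b g p| <= M.

(* A triple ((x, t), s) stands for the point (x, t, s). *)
Definition schwartz (f : R3 -> R[i]) : Prop :=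
  schwartz_real (fun p => complex.Re (f p)) /\
  schwartz_real (fun p => complex.Im (f p)).

Definition hermite_poly (alpha : nat) (x : R) : R :=
  (-1) ^+ alpha * expR (x ^+ 2) * derive1n alpha (fun y : R => expR (- y ^+ 2)) x.

Definition hermite_fun (alpha : nat) (x : R) : R :=
  (2 ^+ alpha * Num.sqrt pi * (alpha`!)%:R) `^ (- 2^-1) *
  hermite_poly alpha x * expR (- x ^+ 2 / 2).

Definition scaled_hermite_fun (alpha : nat) (lambda x : R) : R :=
  `|lambda| `^ (4^-1) * hermite_fun alpha (Num.sqrt `|lambda| * x).

Definition hermite_fourier (f : R3 -> R[i]) (p : nat * R * R) : R[i] :=
  let: (alpha, lambda, nu) := p in
  cintegral (fun x => cintegral (fun t => cintegral (fun s =>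
    cexpi (lambda * t) * cexpi (nu * s) * f (x, t, s) *
    Complex (scaled_hermite_fun alpha lambda x) 0))).

Definition surface : set (nat * R * R) :=
  [set p | p.1.2 != 0 /\ p.2 = (2 * p.1.1 + 1)%:R * `|p.1.2|].

(* The value 0 off the surface is a convention; sigma_loc_integral only
   evaluates its argument at points of the surface. *)
Definition restriction_op (f : R3 -> R[i]) : nat * R * R -> R[i] :=
  patch (fun=> 0) surface (hermite_fourier f).

Local Open Scope ereal_scope.

Definition sigma_loc_integral (psi : R -> R) (Theta : nat * R * R -> \bar R)
    : \bar R :=
  \sum_(0 <= alpha <oo) \int[mu]_(lambda in [set l : R | l != 0%R])
    (Theta (alpha, lambda, ((2 * alpha + 1)%:R * `|lambda|)%R) *
     (psi ((2 * alpha + 1)%:R * `|lambda|)%R)%:E).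

Definition L2_sigma_loc_norm (psi : R -> R) (F : nat * R * R -> R[i])
    : \bar R :=
  (sigma_loc_integral psi (fun p => ((cmod (F p)) ^+ 2)%:E)) `^ (2^-1).

Definition mixed_norm (q : R) (f : R3 -> R[i]) : \bar R :=
  \int[mu]_t ((\int[mu]_s
    ((\int[mu]_x ((cmod (f (x, t, s))) ^+ 2)%:E) `^ (q / 2))) `^ (q^-1)).

End defs.

(* Main.v *)
(* Since [nu = (2 alpha + 1) |lambda|] on the surface, the change of variables
   [lambda -> nu] turns the squared norm into
     sum_alpha (2 alpha + 1)^-1 * integral of [psi nu * |hat f|^2] in [nu].
   For [nu] fixed, [hat f] pairs the partial Fourier transform [F(x, t, nu)] of
   [f] in [s] with [Phi_alpha^lambda (x)], a normalised function essentially
   living in [|x| <= (2 alpha + 1) / sqrt nu].  Cauchy-Schwarz with a weight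
   [w_alpha(x) > 0] gives
     |hat f|^2 <= (int |Phi|^2 / w_alpha) (int w_alpha (int |F| dt)^2 dx),
   where the first factor is bounded uniformly in [alpha] (the oscillator
   equation bounds [Phi_alpha^2] by [8 / sqrt (2 alpha + 1)] in the bulk) and
   [sum_alpha w_alpha / (2 alpha + 1) <= 1] by telescoping.  The sum over
   [alpha] thus disappears, and a second weighted Cauchy-Schwarz in [t]
   reduces the claim to a bound at fixed [t],
     int int psi nu * |F(x, t, nu)|^2 dnu dx <= C ||f(., t, .)||^2_{L^q_s L^2_x}.
   Bounding [psi] by a multiple of a parabola supported in [[-M, M]], this is a
   bilinear form in [s, s'] whose kernel, the Fourier transform of the
   parabola, is O(1 / (1 + (s - s')^2)): it acts from L^q to its dual when
   [1 <= q <= 2]. *)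

From HB Require Import structures.
Require Import Defs.
From mathcomp Require Import measurable_realfun ring lra.

Set Implicit Arguments.
Unset Strict Implicit.
Unset Printing Implicit Defensive.

Import Order.TTheory GRing.Theory Num.Theory.
Import numFieldNormedType.Exports.

Local Open Scope classical_set_scope.
Local Open Scope ring_scope.

(** * Integration tools *)

(** Cauchy-Schwarz without a weight leaves the sum of [1 / (2 alpha + 1)], which diverges
    logarithmically. The weight cures exactly this. With [U = sqrt (2 alpha + 1)] and
    [t = (1 + nu x^2)^(1/4)] the turning point is at [U ~ t]; there [w_alpha = U t / (U + t)^2] has
    size one, and it decays like a power of the ratio of [U] and [t] on either side, which makes the
    sum over [alpha] converge at each [x]. The price is a factor [U / t] in [1 / w_alpha], large
    near the origin, where the L^2 norm of [Phi] gives no control. This is why a pointwise bound is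
    needed: it leaves the integral of [1 / t], and in oscillator units [t ~ sqrt (U |x|)], whose
    inverse has a bounded integral over [|x| <= U / 2]. The parabola is chosen because it vanishes
    at [-M] and [M]: its transform decays quadratically, whereas a sharp cutoff would only give
    [1 / |s|], which is not integrable. *)

Section integration_tools.
Context d (T : measurableType d) (R : realType) (mu : {measure set T -> \bar R}).
Local Open Scope ereal_scope.

(** Compares the suprema over simple functions that define the two integrals. It serves for
    integrands whose measurability is never established, such as those built from
    [restriction_op]. *)
Lemma ge0_le_integral_nomeas (D : set T) (f g : T -> \bar R) :
  (forall x, D x -> 0 <= f x) -> (forall x, D x -> f x <= g x) ->
  \int[mu]_(x in D) f x <= \int[mu]_(x in D) g x.
Proof.
move=> f0 fg.
have fD0 x : 0 <= (f \_ D) x by rewrite patchE; case: ifPn => // /set_mem /f0.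
have fgD x : (f \_ D) x <= (g \_ D) x.
  by rewrite !patchE; case: ifPn => // /set_mem /fg.
rewrite [leLHS]integral_mkcond [leRHS]integral_mkcond.
rewrite !ge0_integralTE//; last by move=> x; exact: le_trans (fgD x).
apply: le_ereal_sup => _ [h hf <-]; exists h => // x.
exact: le_trans (fgD x).
Qed.

Lemma ge0_integralZl_real (r : R) (f : T -> \bar R) :
  (0 <= r)%R -> measurable_fun setT f -> (forall x, 0 <= f x) ->
  \int[mu]_x (r%:E * f x) = r%:E * \int[mu]_x f x.
Proof. by move=> r0 mf f0; rewrite ge0_integralZl. Qed.

Lemma ge0_integralDT (f g : T -> \bar R) :
  measurable_fun setT f -> measurable_fun setT g ->
  (forall x, 0 <= f x) -> (forall x, 0 <= g x) ->
  \int[mu]_x (f x + g x) = \int[mu]_x f x + \int[mu]_x g x.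
Proof. by move=> mf mg f0 g0; rewrite ge0_integralD. Qed.

(** Integrate the inequality [c <= t a / 2 + b / (2 t)] and optimise over [t > 0]. Stating the
    hypothesis as [c c <= a b] avoids square roots of extended reals and lets iterated integrals,
    possibly infinite, be inserted. *)
Lemma integral_cauchy_schwarz (a b c : T -> \bar R) (A B : R) :
  measurable_fun setT a -> measurable_fun setT b ->
  (forall x, 0 <= a x) -> (forall x, 0 <= b x) -> (forall x, 0 <= c x) ->
  (forall x, c x * c x <= a x * b x) ->
  (0 <= A)%R -> (0 <= B)%R ->
  \int[mu]_x a x <= A%:E -> \int[mu]_x b x <= B%:E ->
  \int[mu]_x c x <= (Num.sqrt A * Num.sqrt B)%:E.
Proof.
move=> ma mb a0 b0 c0 cab A0 B0 leA leB.
have amgm (t : R) : (0 < t)%R ->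
    \int[mu]_x c x <= (t / 2 * A + (2 * t)^-1 * B)%:E.
  move=> t0.
  have t20 : (0 <= t / 2)%R by rewrite divr_ge0// ltW.
  have t21 : (0 <= (2 * t)^-1)%R by rewrite invr_ge0 mulr_ge0// ltW.
  apply: (@le_trans _ _ (\int[mu]_x ((t / 2)%:E * a x + (2 * t)^-1%:E * b x))).
    apply: ge0_le_integral_nomeas => // x _.
    have := cab x; have := a0 x; have := b0 x; have := c0 x.
    have t2p : (0 < t / 2)%R by rewrite divr_gt0.
    have tp : (0 < (2 * t)^-1)%R by rewrite invr_gt0 mulr_gt0.
    case: (a x) => [u| |] //; last first.
      by move=> _ v0 _ _; rewrite gt0_muley ?lte_fin// addye ?leey// gt_eqF//
        (lt_le_trans ltNy0)// mule_ge0// lee_fin.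
    case: (b x) => [v| |] //; last first.
      by move=> _ _ _ _; rewrite (@gt0_muley _ (2 * t)^-1%:E) ?lte_fin// addey ?leey.
    case: (c x) => [w| |] //.
    rewrite -!EFinM -EFinD !lee_fin => w0 v0 u0 wuv.
    rewrite -(@ler_pXn2r _ 2) ?nnegrE// ?addr_ge0 ?mulr_ge0 ?(ltW t0)//.
    apply: (@le_trans _ _ (u * v)%R); first by rewrite expr2.
    have -> : ((t / 2 * u + (2 * t)^-1 * v) ^+ 2 =
        u * v + (t / 2 * u - (2 * t)^-1 * v) ^+ 2)%R by field; rewrite gt_eqF.
    by rewrite lerDl sqr_ge0.
  rewrite ge0_integralD//; last 4 first.
  - by move=> x _; rewrite mule_ge0// lee_fin.
  - exact: measurable_funeM.
  - by move=> x _; rewrite mule_ge0// lee_fin.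
  - exact: measurable_funeM.
  rewrite !ge0_integralZl//; try by rewrite lee_fin.
  by rewrite EFinD !EFinM leeD// lee_wpmul2l// lee_fin.
have : 0 <= \int[mu]_x c x by exact: integral_ge0.
have := amgm 1%R ltr01.
case: (\int[mu]_x c x) amgm => [I| |] //= amgm _ _.
rewrite lee_fin; apply/ler_addgt0Pr => e e0.
set p := Num.sqrt A; set r := Num.sqrt B.
have p0 : (0 <= p)%R by exact: sqrtr_ge0.
have r0 : (0 <= r)%R by exact: sqrtr_ge0.
have pA : A = (p ^+ 2)%R by rewrite sqr_sqrtr.
have rB : B = (r ^+ 2)%R by rewrite sqr_sqrtr.
(* The optimal [t] would be [r / p]; shifting both terms by [h] keeps it positive and defined when
   [A] or [B] is zero. The cost is [h (p + r) / 2], which is below [e]. *)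
pose h := (e / (p + r + 1))%R.
have pr1 : (0 < p + r + 1)%R by lra.
have h0 : (0 < h)%R by rewrite divr_gt0.
have he : (h * (p + r) <= e)%R.
  by rewrite /h mulrAC ler_pdivrMr// ler_wpM2l// ?ltW//; lra.
have ph : (0 < p + h)%R by lra.
have rh : (0 < r + h)%R by lra.
have := amgm ((r + h) / (p + h))%R (divr_gt0 rh ph).
rewrite lee_fin => /le_trans; apply.
have l1 : ((r + h) / (p + h) / 2 * A <= (r + h) * p / 2)%R.
  have -> : ((r + h) / (p + h) / 2 * A = (r + h) / 2 * (A / (p + h)))%R.
    by field; rewrite gt_eqF.
  have -> : ((r + h) * p / 2 = (r + h) / 2 * p)%R by field.
  have h1 : (A / (p + h) <= p)%R by rewrite ler_pdivrMr// pA; nra.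
  by apply: ler_wpM2l => //; lra.
have l2 : ((2 * ((r + h) / (p + h)))^-1 * B <= (p + h) * r / 2)%R.
  have -> : ((2 * ((r + h) / (p + h)))^-1 * B = (p + h) / 2 * (B / (r + h)))%R.
    by field; rewrite !gt_eqF.
  have -> : ((p + h) * r / 2 = (p + h) / 2 * r)%R by field.
  have h1 : (B / (r + h) <= r)%R by rewrite ler_pdivrMr// rB; nra.
  by apply: ler_wpM2l => //; lra.
by apply: (le_trans (lerD l1 l2)); nra.
Qed.

Lemma integral_cauchy_schwarz_ereal (a b c : T -> \bar R) (A : R) :
  measurable_fun setT a -> measurable_fun setT b ->
  (forall x, 0 <= a x) -> (forall x, 0 <= b x) -> (forall x, 0 <= c x) ->
  (forall x, c x * c x <= a x * b x) ->
  (0 < A)%R -> \int[mu]_x a x <= A%:E ->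
  (\int[mu]_x c x) * (\int[mu]_x c x) <= A%:E * \int[mu]_x b x.
Proof.
move=> ma mb a0 b0 c0 cab A0 leA.
have : 0 <= \int[mu]_x b x by exact: integral_ge0.
have CS B := @integral_cauchy_schwarz a b c A B ma mb a0 b0 c0 cab (ltW A0).
case: (\int[mu]_x b x) CS => [B| |] //= CS B0; last first.
  by rewrite gt0_muley ?leey// lte_fin.
have {CS} := CS B B0 leA (lexx _).
have : 0 <= \int[mu]_x c x by exact: integral_ge0.
case: (\int[mu]_x c x) => [I| |] //=; rewrite !lee_fin => I0 IAB.
have AE : A = (Num.sqrt A ^+ 2)%R by rewrite sqr_sqrtr// ltW.
have BE : B = (Num.sqrt B ^+ 2)%R by rewrite sqr_sqrtr.
rewrite {1}AE {1}BE -exprMn -expr2.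
by rewrite ler_pXn2r// nnegrE mulr_ge0 ?sqrtr_ge0.
Qed.
End integration_tools.

Section affine_change_of_variables.
Context {R : realType}.
Local Notation mu := (@lebesgue_measure R).
Local Open Scope ereal_scope.

Let aff (c d : R) : R -> measurableTypeR R := fun x => (c * x + d)%R.

Let measurable_aff c d : measurable_fun setT (aff c d).
Proof.
apply: (@measurable_funD _ _ R _ (fun x => c * x)%R (fun=> d)) => //.
exact: measurable_funM.
Qed.

(** Lebesgue measure is determined by its values on half-open intervals, where the factor [c]
    cancels the contraction of the preimage. *)
Let lebesgue_measure_affine (c d : R) (c0 : (0 < c)%R) (A : set R) :
  measurable A -> pushforward (mscale (NngNum (ltW c0)) mu) (aff c d) A = mu A.
Proof.
move=> mA; have maff := measurable_aff c d; apply/esym/lebesgue_measure_unique => //= _ [[a b]] _ <-.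
rewrite /pushforward /mscale /=.
rewrite (_ : aff c d @^-1` _ = `](a - d) / c, (b - d) / c]%classic)%R; last first.
  apply/seteqP; split => x /=; rewrite /aff !in_itv/= => /andP[ax xb].
    by rewrite ltr_pdivrMr// ler_pdivlMr// ltrBlDr lerBrDr mulrC ax xb.
  rewrite ltr_pdivrMr// ltrBlDr mulrC in ax.
  by rewrite ler_pdivlMr// lerBrDr mulrC in xb; rewrite ax.
rewrite !lebesgue_measure_itv/= !lte_fin ltr_pM2r ?invr_gt0// ltrD2r.
case: ifPn => ab; last by rewrite mule0.
by rewrite -!EFinB -EFinM; congr EFin; field; rewrite gt_eqF.
Qed.

Lemma ge0_integral_affine (c d : R) (G : R -> \bar R) : (0 < c)%R ->
  measurable_fun setT G -> (forall x, 0 <= G x) ->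
  \int[mu]_x G (c * x + d)%R = c^-1%:E * \int[mu]_x G x.
Proof.
move=> c0 mG G0.
have -> : \int[mu]_x G x =
    \int[pushforward (mscale (NngNum (ltW c0)) mu) (aff c d)]_x G x.
  by apply: eq_measure_integral => [|? A mA _]; [exact: measurable_aff|exact: esym (lebesgue_measure_affine d c0 mA)].
have -> : \int[pushforward (mscale (NngNum (ltW c0)) mu) (aff c d)]_x G x =
    \int[mscale (NngNum (ltW c0)) mu]_x G (c * x + d)%R.
  have := @ge0_integral_pushforward _ _ (measurableTypeR R) (measurableTypeR R) R _ (measurable_aff c d) (mscale (NngNum (ltW c0)) mu) setT G measurableT mG (fun y _ => G0 y).
  by rewrite preimage_setT => ->.
rewrite ge0_integral_mscale//=; last exact: measurableT_comp mG (measurable_aff c d).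
by rewrite muleA -EFinM mulVf ?gt_eqF// mul1e.
Qed.
End affine_change_of_variables.

Section joint_measurability.
Context d (T : measurableType d) (R : realType).

Let grid (n : nat) (s : R) : R := (Num.floor (n.+1%:R * s))%:~R / n.+1%:R.

Let cvg_grid (s : R) : grid n s @[n --> \oo] --> s.
Proof.
apply/cvgrPdist_le => e e0; near=> n.
have n0 : 0 < n.+1%:R :> R by rewrite ltr0n.
have := ge_floor (n.+1%:R * s); have := floorD1_gt (n.+1%:R * s).
rewrite /grid intrD; set z := _%:~R => h1 h2.
have -> : s - z / n.+1%:R = (n.+1%:R * s - z) / n.+1%:R by field; rewrite gt_eqF.
rewrite ger0_norm; last by rewrite divr_ge0 ?subr_ge0.
apply: (@le_trans _ _ (n.+1%:R^-1)).
  by rewrite ler_pdivrMr// mulVf ?gt_eqF//; lra.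
by apply: ltW; near: n; exact: (near_infty_natSinv_lt (PosNum e0)).
Unshelve. all: by end_near. Qed.

(** [f (y, grid n s)] depends on [s] only through its grid cell, so its preimages are countable
    unions of measurable rectangles; continuity in [s] makes [f] the pointwise limit of these
    functions. *)
Lemma measurable_fun_caratheodory (f : T * R -> R) :
  (forall s, measurable_fun setT (fun y => f (y, s))) ->
  (forall y, continuous (fun s => f (y, s))) ->
  measurable_fun setT f.
Proof.
move=> mf cf.
apply: (@measurable_fun_cvg _ _ R setT (fun n p => f (p.1, grid n p.2))).
  move=> n _ B mB; rewrite setTI.
  rewrite (_ : _ @^-1` _ = \bigcup_(k : int)
    ([set y | B (f (y, k%:~R / n.+1%:R))] `*`
     [set s | (k%:~R <= n.+1%:R * s < (k + 1)%:~R)%R])); last first.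
    apply/seteqP; split => [[y s]/= h|[y s] [k _ [/= h ks]]].
      by exists (Num.floor (n.+1%:R * s)) => //; split => //=; exact: floor_itv.
    by rewrite /grid (floor_def ks).
  apply: countable_bigcupT_measurable => // k.
  apply: measurableX; first by have := mf (k%:~R / n.+1%:R) measurableT B mB; rewrite setTI.
  rewrite (_ : [set _ | _] = `[k%:~R / n.+1%:R, (k + 1)%:~R / n.+1%:R[%classic).
    exact: measurable_itv.
  apply/seteqP; split => s /=; rewrite in_itv/= ler_pdivrMr ?ltr_pdivlMr ?ltr0n//.
    by rewrite mulrC.
  by rewrite mulrC.
move=> [y s] _ /=.
apply: (@continuous_cvg _ _ _ _ _ _ (fun z => f (y, z))); first exact: cf.
exact: cvg_grid.
Qed.
End joint_measurability.

(** * The Fourier transform of a truncated parabola *)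

Section fundamental_theorem.
Context {R : realType}.
Local Notation mu := (@lebesgue_measure R).

Lemma integral_is_derive (f F : R -> R) (a b : R) : a <= b ->
  (forall x : R, is_derive x (1 : R) F (f x)) -> continuous f ->
  (\int[mu]_(x in `[a, b]) (f x)%:E = (F b - F a)%:E)%E.
Proof.
rewrite le_eqVlt => /predU1P[->|ab] dF cf.
  by rewrite subrr set_itv1 integral_set1.
have cF : continuous F.
  move=> x; apply: differentiable_continuous; apply/derivable1_diffP.
  exact: (@ex_derive _ _ _ _ _ _ _ (dF x)).
rewrite (continuous_FTC2 ab (F := F)) ?EFinB//.
- exact: continuous_subspaceT.
- split => [x _| |].
  + exact: (@ex_derive _ _ _ _ _ _ _ (dF x)).
  + exact/cvg_at_right_filter/cF.
  + exact/cvg_at_left_filter/cF.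
- by move=> x _; rewrite derive1E; exact: (@derive_val _ _ _ _ _ _ _ (dF x)).
Qed.

Lemma integral_oneDsqrV : (\int[mu]_x ((oneDsqr x)^-1)%:E = pi%:E)%E.
Proof.
rewrite ge0_symfun_integralT.
- rewrite (_ : [set x | _] = `[0, +oo[%classic); last first.
    by apply/seteqP; split => x /=; rewrite in_itv/= andbT.
  by rewrite integral0y_oneDsqr -EFinM mulrC divfK.
- by move=> x; rewrite invr_ge0.
- exact: continuous_oneDsqrV.
- by move=> x; rewrite /= /oneDsqr sqrrN.
Qed.

Lemma integrable_oneDsqrV : mu.-integrable setT (fun x => ((oneDsqr x)^-1)%:E).
Proof.
apply/integrableP; split.
  apply/measurable_EFinP; apply: continuous_measurable_fun.
  exact: continuous_oneDsqrV.
under eq_integral do rewrite gee0_abs ?lee_fin ?invr_ge0//.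
by rewrite integral_oneDsqrV ltry.
Qed.

(** The whole Fourier transform of the truncated parabola: the sine part vanishes by evenness. *)
Definition parabola_cos (M s : R) : R :=
  \int[mu]_(nu in `[- M, M]) ((M ^+ 2 - nu ^+ 2) * cos (nu * s)).

Lemma continuous_parabola_cos (M s : R) :
  continuous (fun nu : R => (M ^+ 2 - nu ^+ 2) * cos (nu * s)).
Proof.
move=> x; apply: cvgM.
  by apply: cvgB; [exact: cvg_cst|exact: exprn_continuous].
apply: continuous_comp; last exact: continuous_cos.
by apply: cvgM; [exact: cvg_id|exact: cvg_cst].
Qed.

Lemma parabola_cosE (M s : R) : 0 <= M -> s != 0 ->
  parabola_cos M s = 4 * sin (M * s) / s ^+ 3 - 4 * M * cos (M * s) / s ^+ 2.
Proof.
move=> M0 s0; rewrite /parabola_cos /Rintegral.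
(* Two integrations by parts. The first term vanishes at [nu = M] and [nu = - M], which removes the
   contribution of order [1 / s]. *)
pose F (nu : R) := (M ^+ 2 - nu ^+ 2) / s * sin (nu * s) - 2 * nu / s ^+ 2 * cos (nu * s)
  + 2 / s ^+ 3 * sin (nu * s).
have dF (x : R) : is_derive x (1 : R) F ((M ^+ 2 - x ^+ 2) * cos (x * s)).
  rewrite /F; apply: is_derive_eq.
  by rewrite /GRing.scale /=; field.
have MM : - M <= M by lra.
rewrite (integral_is_derive MM dF); last exact: continuous_parabola_cos.
by rewrite /= /F mulNr sinN cosN; field.
Qed.
End fundamental_theorem.

Section product_integrability.
Context d1 d2 (T1 : measurableType d1) (T2 : measurableType d2) (R : realType).
Variables (m1 : {sigma_finite_measure set T1 -> \bar R})
          (m2 : {sigma_finite_measure set T2 -> \bar R}).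
Local Open Scope ereal_scope.

Lemma integrable_prodM (u : T1 -> R) (v : T2 -> R) :
  m1.-integrable setT (EFin \o u) -> m2.-integrable setT (EFin \o v) ->
  (m1 \x m2).-integrable setT (fun p => (u p.1 * v p.2)%:E).
Proof.
move=> iu iv.
have mu := measurable_int _ iu; have mv := measurable_int _ iv.
have {mu}mu : measurable_fun setT u by apply/measurable_EFinP.
have {mv}mv : measurable_fun setT v by apply/measurable_EFinP.
apply/integrable12ltyP.
  apply/measurable_EFinP; apply: measurable_funM.
    exact: measurableT_comp mu measurable_fst.
  exact: measurableT_comp mv measurable_snd.
have /integrableP[_ fv] := iv.
have vfin : \int[m2]_y `|(v y)%:E| \is a fin_num.
  by rewrite ge0_fin_numE// integral_ge0.
rewrite (_ : (fun x => _) = fun x => (fine (\int[m2]_y `|(v y)%:E|))%:E * `|(u x)%:E|).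
  have /integrableP[_ fu] := iu.
  rewrite ge0_integralZl//; last 2 first.
  - by apply: measurableT_comp => //; exact/measurable_EFinP.
  - by rewrite lee_fin fine_ge0// integral_ge0.
  by rewrite fineK//; apply: lte_mul_pinfty => //; exact: integral_ge0.
apply/funext => x; rewrite fineK// muleC -ge0_integralZl//.
  by apply: eq_integral => y _; rewrite EFinM abseM.
by apply: measurableT_comp => //; exact/measurable_EFinP.
Qed.
End product_integrability.

Section parabola_energy.
Context {R : realType}.
Local Notation mu := (@lebesgue_measure R).

Lemma integrable_le_oneDsqrV (B : R) (g : R -> R) : measurable_fun setT g ->
  (forall s, `|g s| <= B * (oneDsqr s)^-1) -> mu.-integrable setT (EFin \o g).
Proof.
move=> mg gB.
apply: (@le_integrable _ (measurableTypeR R) R mu setT measurableT _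
  (fun s => B%:E * ((oneDsqr s)^-1)%:E)%E).
- exact/measurable_EFinP.
- by move=> s _; rewrite -EFinM /= lee_fin (le_trans (gB s))// ler_norm.
- exact: (integrableZl measurableT B integrable_oneDsqrV).
Qed.

Lemma integrable_parabola_cos (M s : R) : mu.-integrable `[- M, M]
  (fun nu => ((M ^+ 2 - nu ^+ 2) * cos (nu * s))%:E).
Proof.
apply: continuous_compact_integrable; first exact: segment_compact.
by apply: continuous_subspaceT; exact: continuous_parabola_cos.
Qed.

(** The trivial bound [2 M^3] serves for [|s| <= 1], where [1 + s^2 <= 2]; beyond, the explicit
    formula gives [(4 + 4 M) / s^2], and [1 + s^2 <= 2 s^2]. The constant is the sum of [4 M^3] and
    [8 + 8 M]. *)
Lemma parabola_cos_le (M s : R) : 0 <= M ->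
  `|parabola_cos M s| <= (4 * M ^+ 3 + 8 * M + 8) * (oneDsqr s)^-1.
Proof.
move=> M0.
have [s1|s1] := leP `|s| 1.
  apply: (@le_trans _ _ (2 * M ^+ 3)).
    have bnd (nu : R) : nu \in `[- M, M] ->
        `|(M ^+ 2 - nu ^+ 2) * cos (nu * s)| <= M ^+ 2.
      rewrite in_itv/= => /andP[nu1 nu2]; rewrite normrM.
      have c1 : `|cos (nu * s)| <= 1 by rewrite ler_norml cos_geN1 cos_le1.
      have n2 : nu ^+ 2 <= M ^+ 2 by nra.
      rewrite ger0_norm ?subr_ge0//.
      have := sqr_ge0 nu; have := normr_ge0 (cos (nu * s)); nra.
    have ip := integrable_parabola_cos M s.
    have ic : mu.-integrable `[- M, M] (EFin \o cst (M ^+ 2)).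
      apply: continuous_compact_integrable; first exact: segment_compact.
      by apply: continuous_subspaceT => x; exact: cvg_cst.
    apply: (le_trans (le_normr_Rintegral _ ip)) => //.
    apply: (@le_trans _ _ (\int[mu]_(nu in `[- M, M]) (M ^+ 2))).
      by apply: le_Rintegral => //; exact: integrable_norm.
    rewrite Rintegral_cst//= lebesgue_measure_itv/= lte_fin.
    by case: ifPn => _ /=; rewrite ?mulr0 ?mulr_ge0 ?exprn_ge0//; lra.
  rewrite ler_pdivlMr ?(lt_le_trans ltr01)// /oneDsqr.
  have : s ^+ 2 <= 1 by rewrite -real_normK ?num_real// expr_le1.
  have : 0 <= M ^+ 3 by rewrite exprn_ge0.
  have := sqr_ge0 s; nra.
have s0 : s != 0 by rewrite -normr_gt0; lra.
rewrite parabola_cosE// (le_trans (ler_normB _ _))//.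
have s2 : 1 <= s ^+ 2 by rewrite -real_normK ?num_real// exprn_ege1// ltW.
have s2p : 0 < s ^+ 2 by lra.
have s3 : s ^+ 2 <= `|s ^+ 3|.
  by rewrite normrX -real_normK ?num_real// ler_weXn2l// ltW.
apply: (@le_trans _ _ ((4 + 4 * M) / s ^+ 2)).
  rewrite [leRHS]mulrDl lerD//.
    rewrite normrM normfV ler_pM ?invr_ge0//.
      rewrite normrM ger0_norm// ler_piMr//.
      by rewrite ler_norml sin_geN1 sin_le1.
    by rewrite lef_pV2 ?posrE ?normr_gt0 ?expf_neq0.
  rewrite normrM normfV (ger0_norm (ltW s2p)) ler_wpM2r ?invr_ge0 ?(ltW s2p)//.
  rewrite normrM ger0_norm ?mulr_ge0// ler_piMr ?mulr_ge0//.
  by rewrite ler_norml cos_geN1 cos_le1.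
rewrite ler_pdivlMr ?(lt_le_trans ltr01)// mulrAC ler_pdivrMr// /oneDsqr.
have : 0 <= M ^+ 3 by rewrite exprn_ge0.
nra.
Qed.
End parabola_energy.

(** * Partial Fourier transforms at a fixed time *)

Section energy.
Context {R : realType}.
Local Notation mu := (@lebesgue_measure R).
Local Notation rT := (measurableTypeR R).

Definition cos_transform (g : R -> R) (nu : R) : R :=
  \int[mu]_s (g s * cos (nu * s)).
Definition sin_transform (g : R -> R) (nu : R) : R :=
  \int[mu]_s (g s * sin (nu * s)).

Lemma measurable_cosM (nu : R) : measurable_fun setT (fun s : R => cos (nu * s)).
Proof.
apply: (measurableT_comp (f := @cos R)).
  by apply: continuous_measurable_fun; exact: continuous_cos.
exact: measurable_funM.
Qed.

Lemma measurable_sinM (nu : R) : measurable_fun setT (fun s : R => sin (nu * s)).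
Proof.
apply: (measurableT_comp (f := @sin R)).
  by apply: continuous_measurable_fun; exact: continuous_sin.
exact: measurable_funM.
Qed.

Lemma normr_cos_le1 (x : R) : `|cos x| <= 1.
Proof. by rewrite ler_norml cos_geN1 cos_le1. Qed.

Lemma normr_sin_le1 (x : R) : `|sin x| <= 1.
Proof. by rewrite ler_norml sin_geN1 sin_le1. Qed.

Variables (B : R) (g : R -> R).
Hypotheses (mg : measurable_fun setT g)
  (gB : forall s, `|g s| <= B * (oneDsqr s)^-1).

Let integrable_g_bounded (u : R -> R) : measurable_fun setT u ->
  (forall s, `|u s| <= 1) -> mu.-integrable setT (fun s => (g s * u s)%:E).
Proof.
move=> mu1 u1; apply: (@integrable_le_oneDsqrV R B); first exact: measurable_funM.
move=> s; rewrite normrM (le_trans _ (gB s))// ler_piMr//.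
Qed.

Let integrable_gcos nu : mu.-integrable setT (fun s => (g s * cos (nu * s))%:E).
Proof.
apply: integrable_g_bounded; first exact: measurable_cosM.
by move=> s; exact: normr_cos_le1.
Qed.

Let integrable_gsin nu : mu.-integrable setT (fun s => (g s * sin (nu * s))%:E).
Proof.
apply: integrable_g_bounded; first exact: measurable_sinM.
by move=> s; exact: normr_sin_le1.
Qed.

Let integrable_g : mu.-integrable setT (EFin \o g).
Proof. exact: integrable_le_oneDsqrV mg gB. Qed.

Let integrable_gg : (mu \x mu)%E.-integrable setT
  (fun z : rT * rT => (g z.1 * g z.2)%:E).
Proof. exact: integrable_prodM. Qed.

Let measurable_ggcos (u : R) : measurable_fun setT
  (fun z : rT * rT => g z.1 * g z.2 * cos (u * (z.1 - z.2))).
Proof.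
apply: (@measurable_funM _ _ R).
  apply: measurable_funM; first exact: measurableT_comp mg measurable_fst.
  exact: measurableT_comp mg measurable_snd.
apply: (measurableT_comp (measurable_cosM u)).
apply: (@measurable_funB _ _ R); [exact: measurable_fst|exact: measurable_snd].
Qed.

Lemma integrable_ggcos (nu : R) : (mu \x mu)%E.-integrable setT
  (fun z : rT * rT => (g z.1 * g z.2 * cos (nu * (z.1 - z.2)))%:E).
Proof.
apply: le_integrable integrable_gg => //; first exact/measurable_EFinP.
by move=> z _ /=; rewrite lee_fin normrM ler_piMr// normr_cos_le1.
Qed.

(** The addition formula for [cos (nu s - nu s')] separates the variables. Read from right to left,
    it puts all dependence on [nu] into one cosine, so that integrating in [nu] first produces
    [parabola_cos (s - s')]. *)
Lemma transform_sqE (nu : R) :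
  (\int[(mu \x mu)%E]_z (g z.1 * g z.2 * cos (nu * (z.1 - z.2)))%:E =
   (cos_transform g nu ^+ 2 + sin_transform g nu ^+ 2)%:E)%E.
Proof.
have ih := integrable_ggcos nu.
rewrite -integral12_prod_meas1//= /fubini_F.
have inner s : (\int[mu]_y (g s * g y * cos (nu * (s - y)))%:E =
    (cos_transform g nu * (g s * cos (nu * s)) +
     sin_transform g nu * (g s * sin (nu * s)))%:E)%E.
  rewrite (eq_integral (fun y : rT => (g s * cos (nu * s))%:E * (g y * cos (nu * y))%:E +
     (g s * sin (nu * s))%:E * (g y * sin (nu * y))%:E)%E); last first.
    move=> y _; rewrite -!EFinM -EFinD mulrBr cosB; congr EFin; ring.
  rewrite integralD//; [|exact: integrableZl|exact: integrableZl].
  rewrite !integralZl// -(fineK (integrable_fin_num measurableT (integrable_gcos nu))).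
  rewrite -(fineK (integrable_fin_num measurableT (integrable_gsin nu))).
  by rewrite -!EFinM -EFinD; congr EFin; rewrite /cos_transform /sin_transform /Rintegral; ring.
under eq_integral do rewrite inner EFinD EFinM (EFinM (sin_transform _ _)).
rewrite integralD//; [|exact: integrableZl|exact: integrableZl].
rewrite !integralZl// -(fineK (integrable_fin_num measurableT (integrable_gcos nu))).
by rewrite -(fineK (integrable_fin_num measurableT (integrable_gsin nu))).
Qed.
End energy.

Section lebesgue2.
Context {R : realType}.
Local Notation mu := (@lebesgue_measure R).
Local Notation rT := (measurableTypeR R).
Local Open Scope ereal_scope.

Lemma sigma_finite_lebesgue2 : sigma_finite [set: rT * rT] (mu \x mu).
Proof.
have /sigma_finiteP[F [TF ndF Foo]] := @sigma_finiteT _ _ _ mu.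
exists (fun n => F n `*` F n).
  rewrite -setXTT TF predeqE => -[x y]; split.
    move=> [/= [n _ Fnx] [k _ Gky]]; exists (maxn n k) => //; split.
    - by move: x Fnx; exact/subsetPset/ndF/leq_maxl.
    - by move: y Gky; exact/subsetPset/ndF/leq_maxr.
  by move=> [n _ []/= ? ?]; split; exists n.
move=> k; have [? ?] := Foo k.
split; first exact: measurableX.
rewrite [ltLHS]product_measure1E// lte_mul_pinfty// ge0_fin_numE//.
Qed.
(* [mu \x mu] is not inferred as a sigma-finite measure: the canonical key
   [product_measure1] is already taken by the product of subprobabilities. *)
Definition lebesgue2 : {sigma_finite_measure set (rT * rT)%type -> \bar R} :=
  HB.pack (mu \x mu)%E (Measure_isSigmaFinite.Build _ _ _ (mu \x mu)%E sigma_finite_lebesgue2).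
End lebesgue2.

(** * The frequency energy as a bilinear form in time *)

Section energy_inequality.
Context {R : realType}.
Local Notation mu := (@lebesgue_measure R).
Local Notation rT := (measurableTypeR R).
Variables (M B : R) (g : R -> R).
Hypotheses (M0 : 0 <= M) (mg : measurable_fun setT g)
  (gB : forall s, `|g s| <= B * (oneDsqr s)^-1).

Let G (nu : R) : R := (M ^+ 2 - nu ^+ 2) * \1_(`[- M, M]%classic) nu.

Let GE (u : R -> R) : (\int[mu]_(nu in `[(- M)%R, M]) ((M ^+ 2 - nu ^+ 2) * u nu)%:E =
  \int[mu]_nu (G nu * u nu)%:E)%E.
Proof.
rewrite integral_mkcond; apply: eq_integral => nu _.
rewrite patchE /G indicE; case: ifPn => _; first by rewrite mulr1.
by rewrite mulr0 mul0r.
Qed.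

Let measurable_G : measurable_fun setT G.
Proof.
apply: measurable_funM; last exact: measurable_indic.
by apply: measurable_funB => //; exact: measurable_funX.
Qed.

Let integrable_G : mu.-integrable setT (fun nu => (G nu)%:E).
Proof.
have ip : mu.-integrable `[- M, M] (fun nu => (M ^+ 2 - nu ^+ 2)%:E).
  apply: continuous_compact_integrable; first exact: segment_compact.
  apply: continuous_subspaceT => x.
  by apply: cvgB; [exact: cvg_cst|exact: exprn_continuous].
have := (integrable_mkcond (fun nu : rT => (M ^+ 2 - nu ^+ 2)%:E) (measurable_itv `[- M, M])).1 ip.
apply: eq_integrable => // nu _; rewrite patchE /G indicE.
by case: ifPn => _; rewrite ?mulr1 ?mulr0.
Qed.

Lemma parabola_energy_le :
  (\int[mu]_(nu in `[(- M)%R, M])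
     ((M ^+ 2 - nu ^+ 2) * (cos_transform g nu ^+ 2 + sin_transform g nu ^+ 2))%:E <=
   \int[mu]_s \int[mu]_s'
     (`|g s| * `|g s'| *
      ((4 * M ^+ 3 + 8 * M + 8) * (oneDsqr (s - s'))^-1))%:E)%E.
Proof.
have integrable_g : mu.-integrable setT (EFin \o g).
  exact: integrable_le_oneDsqrV mg gB.
have integrable_gg : (mu \x mu)%E.-integrable setT
    (fun z : rT * rT => (g z.1 * g z.2)%:E) by exact: integrable_prodM.
pose gg (z : rT * rT) : R := g z.1 * g z.2.
have m1 : measurable_fun setT (fun z : rT * rT => g z.1).
  exact: measurableT_comp mg measurable_fst.
have m2 : measurable_fun setT (fun z : rT * rT => g z.2).
  exact: measurableT_comp mg measurable_snd.
have mgg : measurable_fun setT gg by exact: measurable_funM.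
have mB : measurable_fun setT (fun z : rT * rT => z.1 - z.2 : R).
  by apply: (@measurable_funB _ _ R); [exact: measurable_fst|exact: measurable_snd].
pose H (p : rT * (rT * rT)) : R := G p.1 * (gg p.2 * cos (p.1 * (p.2.1 - p.2.2))).
have mH : measurable_fun setT H.
  apply: (@measurable_funM _ _ R).
    exact: measurableT_comp measurable_G measurable_fst.
  apply: (@measurable_funM _ _ R).
    exact: measurableT_comp mgg measurable_snd.
  apply: (measurableT_comp (f := @cos R)).
    by apply: continuous_measurable_fun; exact: continuous_cos.
  apply: (@measurable_funM _ _ R); first exact: measurable_fst.
  exact: measurableT_comp mB measurable_snd.
(* Signs matter here, so Fubini needs absolute integrability: as the cosine is at most one, [H] is
   dominated by the product of the integrable functions [G] and [gg]. *)
have iH : (mu \x lebesgue2)%E.-integrable setT (EFin \o H).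
  have := @integrable_prodM _ _ rT (rT * rT)%type R mu lebesgue2 G gg integrable_G integrable_gg.
  apply: le_integrable => //; first exact/measurable_EFinP.
  move=> p _ /=; rewrite lee_fin !normrM ler_wpM2l// ler_piMr ?mulr_ge0//.
  by rewrite normr_cos_le1.
rewrite GE.
rewrite (_ : (\int[mu]_nu _)%E =
   \int[mu]_nu \int[(mu \x mu)%E]_z (EFin \o H) (nu, z))%E; last first.
  apply: eq_integral => nu _.
  rewrite EFinM -(transform_sqE mg gB) -integralZl//.
  exact: integrable_ggcos mg gB nu.
rewrite (Fubini iH).
apply: (@le_trans _ _ (\int[(mu \x mu)%E]_z `|\int[mu]_nu (EFin \o H) (nu, z)|)%E).
  apply: le_trans (lee_abs _) _; apply: le_abse_integral => //.
  exact: measurable_fubini_G iH.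
pose Q (z : rT * rT) : R := `|g z.1| * `|g z.2| *
  ((4 * M ^+ 3 + 8 * M + 8) * (oneDsqr (z.1 - z.2 : R))^-1).
have mQ : measurable_fun setT Q.
  apply: (@measurable_funM _ _ R).
    by apply: (@measurable_funM _ _ R); apply: measurableT_comp.
  apply: (@measurable_funM _ _ R) => //.
  apply: (measurableT_comp (f := fun x => (oneDsqr x)^-1)) mB.
  by apply: continuous_measurable_fun; exact: continuous_oneDsqrV.
have Q0 z : (0 <= (Q z)%:E)%E.
  by rewrite lee_fin !mulr_ge0// ?invr_ge0// !addr_ge0// ?mulr_ge0 ?exprn_ge0.
apply: (@le_trans _ _ (\int[(mu \x mu)%E]_z (Q z)%:E)%E).
  apply: ge0_le_integral_nomeas => // z _.
  rewrite (_ : (\int[mu]_nu _)%E = (gg z * parabola_cos M (z.1 - z.2))%:E).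
    rewrite /= lee_fin !normrM ler_wpM2l ?mulr_ge0//.
    exact: parabola_cos_le.
  rewrite /H /= -(GE (fun nu => gg z * cos (nu * (z.1 - z.2)))).
  under eq_integral do rewrite mulrCA EFinM.
  have ip := integrable_parabola_cos M (z.1 - z.2).
  by rewrite integralZl// -(fineK (integrable_fin_num _ ip)).
rewrite fubini_tonelli1//; exact/measurable_EFinP.
Qed.
End energy_inequality.

(** * Convolution with [1 / (1 + s^2)] between L^q and its dual *)

Section young.
Context {R : realType}.
Local Notation mu := (@lebesgue_measure R).
Local Notation rT := (measurableTypeR R).

(** Take [x <= y]. If [y <= 1] then [x y <= y^2 <= y^q], by [q <= 2]; if [x <= 1 < y] then
    [x y <= y <= y^q]; if both exceed one then [x y <= x^q y^q]. Multiplied by a kernel that is both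
    bounded and integrable, each of the three terms is integrable in the two variables, which
    replaces Young's inequality. *)
Lemma mulr_le_powR (q x y : R) : 1 <= q <= 2 -> 0 <= x -> 0 <= y ->
  x * y <= x `^ q * y `^ q + x `^ q + y `^ q.
Proof.
move=> /andP[q1 q2].
wlog xy : x y / x <= y.
  move=> wl x0 y0; have [xy|/ltW yx] := leP x y; first exact: wl.
  have := wl _ _ yx y0 x0; nra.
move=> x0 y0.
have px := powR_ge0 x q; have py := powR_ge0 y q.
have [y1|y1] := leP y 1.
  have yq : y ^+ 2 <= y `^ q.
    have [->|yn0] := eqVneq y 0; first by rewrite expr0n powR_ge0.
    rewrite -powR_mulrn// /powR (negPf yn0).
    rewrite ler_expR ler_wnM2r//; first by rewrite ln_le0.
  apply: (@le_trans _ _ (y `^ q)); last by nra.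
  by apply: le_trans yq; nra.
have yq : y <= y `^ q.
  rewrite -[leLHS]powRr1//; apply: ler_powR => //; exact: ltW.
have [x1|x1] := leP x 1; first by nra.
have xq : x <= x `^ q.
  by rewrite -[leLHS]powRr1//; apply: ler_powR => //; exact: ltW.
nra.
Qed.

Local Open Scope ereal_scope.

Lemma integral_oneDsqrV_shift (s : R) :
  \int[mu]_s' ((oneDsqr (s - s')%R)^-1)%:E = pi%:E.
Proof.
have := @ge0_integral_affine R 1 (- s)%R (fun x => ((oneDsqr x)^-1)%:E) ltr01.
rewrite integral_oneDsqrV invr1 mul1e => <-.
- apply: eq_integral => x _; rewrite mul1r /oneDsqr.
  by rewrite -sqrrN opprB.
- apply/measurable_EFinP; apply: continuous_measurable_fun.
  exact: continuous_oneDsqrV.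
- by move=> x; rewrite lee_fin invr_ge0.
Qed.

Lemma measurable_oneDsqrVB :
  measurable_fun setT (fun z : rT * rT => ((oneDsqr (z.1 - z.2 : R))^-1)%R).
Proof.
apply: (measurableT_comp (f := fun x : R => ((oneDsqr x)^-1)%R)).
  by apply: continuous_measurable_fun; exact: continuous_oneDsqrV.
by apply: (@measurable_funB _ _ R); [exact: measurable_fst|exact: measurable_snd].
Qed.

(* The integrable kernel [1 / (1 + s^2)] is bounded by [1], so it acts from
   L^q to L^q' for every [q] in [1, 2]. *)
Lemma oneDsqrV_convolution_le (q : R) (a : R -> R) (n : R) :
  (1 <= q <= 2)%R -> (0 < n)%R -> measurable_fun setT a -> (forall s, (0 <= a s)%R) ->
  \int[mu]_s ((a s `^ q)%R)%:E <= (n `^ q)%:E ->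
  \int[mu]_s \int[mu]_s' ((a s * a s' * (oneDsqr (s - s'))^-1)%R)%:E <=
  (n ^+ 2 * (1 + pi + pi))%:E.
Proof.
move=> q12 n0 ma a0 an.
(* After division by [n] the q-th power has integral at most one. The three terms of [mulr_le_powR]
   then contribute [1] (kernel at most one), [pi] and [pi] (the mass of the kernel). *)
pose b s := ((a s / n) `^ q)%R.
have b0 s : (0 <= b s)%R by exact: powR_ge0.
have mb : measurable_fun setT b.
  apply: (measurableT_comp (f := fun x : R => (x `^ q)%R)).
    exact: measurable_powR.
  exact: measurable_funM.
have mEb : measurable_fun setT (EFin \o b) by exact/measurable_EFinP.
have n2 : (0 <= n ^+ 2)%R by rewrite exprn_ge0// ltW.
have b1 : \int[mu]_s (b s)%:E <= 1.
  rewrite (eq_integral (fun s : rT => (n^-1 `^ q)%:E * ((a s `^ q)%R)%:E)); last first.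
    move=> s _; rewrite -EFinM; congr EFin.
    by rewrite mulrC -powRM// invr_ge0 ltW.
  rewrite ge0_integralZl_real ?powR_ge0//; last 2 first.
  - apply/measurable_EFinP.
    apply: (measurableT_comp (f := fun x : R => (x `^ q)%R)) ma.
    exact: measurable_powR.
  - by move=> s; rewrite lee_fin powR_ge0.
  apply: (@le_trans _ _ ((n^-1 `^ q)%:E * (n `^ q)%:E)).
    by rewrite lee_wpmul2l// lee_fin powR_ge0.
  by rewrite -EFinM -powRM ?invr_ge0 ?(ltW n0)// mulVf ?gt_eqF// powR1.
pose k (z : rT * rT) : R := ((oneDsqr (z.1 - z.2 : R))^-1)%R.
have k0 z : (0 <= k z)%R by rewrite invr_ge0.
have k1 z : (k z <= 1)%R by exact: oneDsqrV_le1.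
have mk : measurable_fun setT k by exact: measurable_oneDsqrVB.
pose J (s : rT) : \bar R := \int[mu]_s' (k (s, s') * b s')%:E.
have mJ : measurable_fun setT J.
  apply: (measurable_fun_fubini_tonelli_F (m2 := mu) (fun z : rT * rT => (k z * b z.2)%:E)).
    apply/measurable_EFinP; apply: measurable_funM => //.
    exact: measurableT_comp mb measurable_snd.
  by move=> z; rewrite lee_fin mulr_ge0.
have J0 s : 0 <= J s by apply: integral_ge0 => s' _; rewrite lee_fin mulr_ge0.
have JE : \int[mu]_s J s <= pi%:E.
  rewrite /J (fubini_tonelli (fun z : rT * rT => (k z * b z.2)%:E)); last 2 first.
  - apply/measurable_EFinP; apply: measurable_funM => //.
    exact: measurableT_comp mb measurable_snd.
  - by move=> z; rewrite lee_fin mulr_ge0.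
  rewrite (eq_integral (fun s' : rT => pi%:E * (b s')%:E)); last first.
    move=> s' _; rewrite -(integral_oneDsqrV_shift s') muleC -ge0_integralZl_real//.
    - apply: eq_integral => s _; rewrite -EFinM mulrC /k /=.
      by rewrite /oneDsqr -sqrrN opprB.
    - apply/measurable_EFinP.
      exact: (measurable_fun_pair2 s' mk).
  rewrite ge0_integralZl_real ?pi_ge0//.
  by rewrite -[leRHS]mule1; apply: lee_wpmul2l => //; rewrite lee_fin pi_ge0.
apply: (@le_trans _ _ (\int[mu]_s ((n ^+ 2)%:E *
    ((1 + pi)%:E * (b s)%:E + J s)))).
  apply: ge0_le_integral_nomeas => s _.
    apply: integral_ge0 => s' _.
    by rewrite lee_fin !mulr_ge0// invr_ge0.
  apply: (@le_trans _ _ (\int[mu]_s' ((n ^+ 2)%:E *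
     ((b s)%:E * (b s')%:E + (b s)%:E * (k (s, s'))%:E + (k (s, s') * b s')%:E)))).
    apply: ge0_le_integral_nomeas => s' _.
      by rewrite lee_fin !mulr_ge0// invr_ge0.
    rewrite (_ : (n ^+ 2)%:E * _ = (n ^+ 2 *
      (b s * b s' + b s * k (s, s') + k (s, s') * b s'))%R%:E)// lee_fin.
    have := @mulr_le_powR q (a s / n) (a s' / n) q12 _ _.
    rewrite -/(b s) -/(b s') !divr_ge0 ?(ltW n0)// => /(_ isT isT) h.
    rewrite -/(k (s, s')).
    have -> : (a s * a s' * k (s, s') =
       n ^+ 2 * (a s / n * (a s' / n) * k (s, s')))%R by field; rewrite gt_eqF.
    rewrite ler_wpM2l//.
    have := k0 (s, s'); have := k1 (s, s'); have := b0 s; have := b0 s'.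
    move: h; set u := (a s / n * _)%R; move: (b s) (b s') (k _) => x y z h y0 x0 z1 z0.
    apply: (le_trans (ler_wpM2r z0 h)).
    have : (0 <= x * y * (1 - z))%R by rewrite !mulr_ge0 ?subr_ge0.
    nra.
  have mks : measurable_fun setT (fun s' : rT => k (s, s')).
    exact: (measurable_fun_pair2 s mk).
  have mkb : measurable_fun setT (fun s' : rT => (k (s, s') * b s')%:E).
    by apply/measurable_EFinP; exact: measurable_funM.
  have mks' : measurable_fun setT (fun s' : rT => (k (s, s'))%:E).
    exact/measurable_EFinP.
  have bb0 s' : 0 <= (b s)%:E * (b s')%:E by rewrite -EFinM lee_fin mulr_ge0.
  have bk0 s' : 0 <= (b s)%:E * (k (s, s'))%:E by rewrite -EFinM lee_fin mulr_ge0.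
  have kb0 s' : 0 <= (k (s, s') * b s')%:E by rewrite lee_fin mulr_ge0.
  have mbb : measurable_fun setT (fun s' : rT => (b s)%:E * (b s')%:E).
    exact: measurable_funeM.
  have mbk : measurable_fun setT (fun s' : rT => (b s)%:E * (k (s, s'))%:E).
    exact: measurable_funeM.
  have mD : measurable_fun setT
      (fun s' : rT => (b s)%:E * (b s')%:E + (b s)%:E * (k (s, s'))%:E).
    exact: emeasurable_funD.
  rewrite ge0_integralZl_real//; last 2 first.
  - exact: emeasurable_funD.
  - by move=> s'; rewrite !adde_ge0.
  rewrite lee_wpmul2l ?lee_fin//.
  rewrite ge0_integralDT//; last by move=> s'; rewrite adde_ge0.
  rewrite leeD2r// ge0_integralDT// !ge0_integralZl_real//.
  - rewrite integral_oneDsqrV_shift -muleDr// ?fin_num_adde_defl//.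
    rewrite [leRHS]muleC; apply: lee_wpmul2l; rewrite ?lee_fin//.
    by rewrite (_ : (1 + pi)%:E = 1 + pi%:E)//; apply: leeD.
    by move=> s'; rewrite lee_fin.
have mpb : measurable_fun setT (fun s => (1 + pi)%:E * (b s)%:E).
  exact: measurable_funeM.
have pi1 : (0 <= 1 + pi :> R)%R by rewrite addr_ge0// pi_ge0.
have pb0 s : 0 <= (1 + pi)%:E * (b s)%:E by rewrite -EFinM lee_fin mulr_ge0.
rewrite ge0_integralZl_real//; last 2 first.
- exact: emeasurable_funD.
- by move=> s; rewrite adde_ge0.
rewrite (_ : (n ^+ 2 * (1 + pi + pi))%:E = (n ^+ 2)%:E * (1 + pi + pi)%:E)//.
apply: lee_wpmul2l; rewrite ?lee_fin// ge0_integralDT//.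
rewrite (_ : (1 + pi + pi)%:E = (1 + pi)%:E + pi%:E)//; apply: leeD => //.
rewrite ge0_integralZl_real// -[leRHS]mule1.
by apply: lee_wpmul2l; rewrite ?lee_fin.
Qed.
End young.

Ltac measurable_proj := solve [repeat first
  [ exact: measurable_id | exact: measurable_cst | exact: measurable_fst
  | exact: measurable_snd | apply: measurable_fun_pair
  | apply: (measurableT_comp measurable_fst)
  | apply: (measurableT_comp measurable_snd) ]].

(** * Energy of a slice at fixed time *)

Section slice.
Context {R : realType}.
Local Notation mu := (@lebesgue_measure R).
Local Notation rT := (measurableTypeR R).
Local Open Scope ereal_scope.

Lemma subr_sqr_ge0 (M x : R) : (- M <= x <= M)%R -> (0 <= M ^+ 2 - x ^+ 2)%R.
Proof. by move=> /andP[h1 h2]; nra. Qed.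

(** The kernel of the bilinear form does not involve [x]. By Tonelli the [x]-integral therefore
    falls on [|g (x, s)| |g (x, s')|] alone, and Cauchy-Schwarz bounds it by [a s * a s'], leaving a
    scalar convolution estimate. *)
Lemma slice_energy_le (q M B : R) (g : rT * rT -> R) (a : R -> R) (n : R) :
  (1 <= q <= 2)%R -> (0 <= M)%R -> measurable_fun setT g ->
  (forall x s, (`|g (x, s)| <= B * (oneDsqr s)^-1)%R) ->
  measurable_fun setT a -> (forall s, (0 <= a s)%R) ->
  (forall s, \int[mu]_x ((g (x, s) ^+ 2)%R)%:E <= (a s ^+ 2)%:E) ->
  (0 < n)%R -> \int[mu]_s ((a s `^ q)%R)%:E <= (n `^ q)%:E ->
  \int[mu]_x \int[mu]_(nu in `[(- M)%R, M])
    (((M ^+ 2 - nu ^+ 2) * (cos_transform (fun s => g (x, s)) nu ^+ 2 +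
                            sin_transform (fun s => g (x, s)) nu ^+ 2))%R)%:E <=
  ((4 * M ^+ 3 + 8 * M + 8) * (n ^+ 2 * (1 + pi + pi)))%:E.
Proof.
move=> q12 M0 mg gB ma a0 ga n0 an.
pose c := (4 * M ^+ 3 + 8 * M + 8)%R.
have c0 : (0 <= c)%R by rewrite !addr_ge0// ?mulr_ge0 ?exprn_ge0.
pose k (z : rT * rT) : R := ((oneDsqr (z.1 - z.2 : R))^-1)%R.
have k0 z : (0 <= k z)%R by rewrite invr_ge0.
have mk : measurable_fun setT k by exact: measurable_oneDsqrVB.
pose P (x s s' : rT) : R := (`|g (x, s)| * `|g (x, s')| * (c * k (s, s')))%R.
have P0 x s s' : 0 <= (P x s s')%:E by rewrite lee_fin !mulr_ge0.
have mabsg : measurable_fun setT (fun p : rT * rT => `|g p|%R).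
  exact: measurableT_comp.
have mP : measurable_fun setT (fun p : (rT * rT) * rT => (P p.1.1 p.1.2 p.2)%:E).
  apply/measurable_EFinP; apply: (@measurable_funM _ _ R).
    apply: (@measurable_funM _ _ R).
      apply: (measurableT_comp mabsg (g := fun p : (rT * rT) * rT => (p.1.1, p.1.2))).
      measurable_proj.
    apply: (measurableT_comp mabsg (g := fun p : (rT * rT) * rT => (p.1.1, p.2))).
    measurable_proj.
  apply: (@measurable_funM _ _ R) => //.
  apply: (measurableT_comp mk (g := fun p : (rT * rT) * rT => (p.1.2, p.2))).
  measurable_proj.
have mPs s : measurable_fun setT (fun p : rT * rT => (P p.1 s p.2)%:E).
  apply: (measurableT_comp mP (g := fun p : rT * rT => ((p.1, s), p.2))).
  measurable_proj.
have mPss s s' : measurable_fun setT (fun x : rT => (`|g (x, s)| * `|g (x, s')|)%R%:E).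
  apply/measurable_EFinP; apply: (@measurable_funM _ _ R).
    exact: (measurable_fun_pair1 s mabsg).
  exact: (measurable_fun_pair1 s' mabsg).
have mak : measurable_fun setT (fun p : rT * rT => (a p.1 * a p.2 * k p)%R%:E).
  apply/measurable_EFinP; apply: (@measurable_funM _ _ R) => //.
  by apply: (@measurable_funM _ _ R); apply: measurableT_comp.
apply: (@le_trans _ _ (\int[mu]_x \int[mu]_s \int[mu]_s' (P x s s')%:E)).
  apply: ge0_le_integral_nomeas => x _.
    apply: integral_ge0 => nu /=; rewrite in_itv/= => /andP[nu1 nu2].
    rewrite lee_fin; apply: mulr_ge0; last by rewrite addr_ge0 ?sqr_ge0.
    by apply: subr_sqr_ge0; rewrite nu1.
  apply: (@parabola_energy_le R M B (fun s => g (x, s)) M0) => //.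
  exact: (measurable_fun_pair2 x mg).
rewrite (fubini_tonelli (fun p : rT * rT => \int[mu]_s' (P p.1 p.2 s')%:E)); last 2 first.
- exact: (measurable_fun_fubini_tonelli_F (m2 := mu) _ mP).
- by move=> p; apply: integral_ge0.
apply: (@le_trans _ _ (\int[mu]_s \int[mu]_s' (c%:E * ((a s * a s' * k (s, s'))%R)%:E))).
  apply: ge0_le_integral_nomeas => s _.
    by apply: integral_ge0 => x _; apply: integral_ge0.
  rewrite (fubini_tonelli (fun p : rT * rT => (P p.1 s p.2)%:E)) //.
  apply: ge0_le_integral_nomeas => s' _; first exact: integral_ge0.
  rewrite /P /=.
  rewrite (eq_integral (fun x : rT => (c * k (s, s'))%:E * ((`|g (x, s)| * `|g (x, s')|)%R)%:E)); last first.
    by move=> x _; rewrite -EFinM mulrC.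
  rewrite ge0_integralZl_real; last 3 first.
  - by rewrite mulr_ge0.
  - exact: mPss.
  - by move=> x; rewrite lee_fin mulr_ge0.
  rewrite -EFinM (_ : (c * (a s * a s' * k (s, s')))%R = (c * k (s, s') * (a s * a s'))%R); last by ring.
  rewrite [leRHS]EFinM; apply: lee_wpmul2l; first by rewrite lee_fin mulr_ge0.
  have sqa u : a u = Num.sqrt (a u ^+ 2) by rewrite sqrtr_sqr ger0_norm.
  rewrite (sqa s) (sqa s').
  apply: (@integral_cauchy_schwarz _ _ _ mu (fun x : rT => (g (x, s) ^+ 2)%:E)
    (fun x : rT => (g (x, s') ^+ 2)%:E)); rewrite ?sqr_ge0//.
  - by apply/measurable_EFinP; apply: measurable_funX; exact: (measurable_fun_pair1 s mg).
  - by apply/measurable_EFinP; apply: measurable_funX; exact: (measurable_fun_pair1 s' mg).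
  - by move=> x; rewrite lee_fin sqr_ge0.
  - by move=> x; rewrite lee_fin sqr_ge0.
  - move=> x; rewrite -!EFinM lee_fin.
    by rewrite mulrACA -!expr2 !real_normK ?num_real.
have ak0 s s' : 0 <= ((a s * a s' * k (s, s'))%R)%:E by rewrite lee_fin !mulr_ge0.
rewrite (eq_integral (fun s : rT => c%:E * \int[mu]_s' ((a s * a s' * k (s, s'))%R)%:E)); last first.
  by move=> s _; rewrite ge0_integralZl_real//; exact: (measurable_fun_pair2 s mak).
rewrite ge0_integralZl_real//; last 2 first.
- exact: (measurable_fun_fubini_tonelli_F (m2 := mu) _ mak).
- by move=> s; apply: integral_ge0.
rewrite [leRHS]EFinM; apply: lee_wpmul2l; first by rewrite lee_fin.
exact: (@oneDsqrV_convolution_le R q).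
Qed.
End slice.

(** * Hermite functions in weighted L2 spaces *)

Section hermite_polynomials.
Context {R : realType}.
Local Notation mu := (@lebesgue_measure R).

(** The Hermite polynomials as formal polynomials, through the raising recurrence obtained by
    differentiating [H_n(x) e^(-x^2)]; their differential identities become identities in a
    polynomial ring. *)
Fixpoint hermite_pol (n : nat) : {poly R} :=
  if n is n'.+1 then 2 * 'X * hermite_pol n' - (hermite_pol n')^`() else 1.

Let deriv_natM m (p : {poly R}) : (m%:R * p)^`() = m%:R * p^`().
Proof. by rewrite !mulr_natl derivMn. Qed.

Let deriv_2XM (p : {poly R}) : (2 * 'X * p)^`() = 2 * p + 2 * 'X * p^`().
Proof. by rewrite -!mulrA deriv_natM derivM derivX mul1r mulrDr. Qed.

Lemma deriv_hermite_pol n : (hermite_pol n.+1)^`() = (2 * n.+1)%:R * hermite_pol n.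
Proof.
elim: n => [|n IH].
  by rewrite /= derivB deriv_2XM derivC deriv0 mulr0 addr0 subr0 muln1.
have E : hermite_pol n.+2 = 2 * 'X * hermite_pol n.+1 - (hermite_pol n.+1)^`() by [].
rewrite E derivB deriv_2XM IH deriv_natM.
have -> : (2 * n.+2)%:R = 2 + (2 * n.+1)%:R :> {poly R}.
  by rewrite -natrD mulnS.
rewrite (_ : hermite_pol n.+1 = 2 * 'X * hermite_pol n - (hermite_pol n)^`())//; ring.
Qed.

Lemma hermite_pol_ode n :
  (hermite_pol n)^`()^`() = 2 * 'X * (hermite_pol n)^`() - (2 * n)%:R * hermite_pol n.
Proof.
have := deriv_hermite_pol n; rewrite /= derivB deriv_2XM => H.
have E : (2 * n)%:R = (2 * n.+1)%:R - 2 :> {poly R}.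
  by rewrite mulnS natrD [RHS]addrAC subrr add0r.
rewrite E mulrBl -H; ring.
Qed.

Lemma is_derive_gauss (a : R) (p : {poly R}) (x : R) :
  is_derive x (1 : R) (fun y : R => p.[y] * expR (a * y ^+ 2))
    ((p^`() + (2 * a)%:P * 'X * p).[x] * expR (a * x ^+ 2)).
Proof.
apply: is_derive_eq; rewrite !hornerE /GRing.scale /=; ring.
Qed.

Lemma hermite_polyE n x : hermite_poly n x = (hermite_pol n).[x].
Proof.
have H k : derive1n k (fun y : R => expR (- y ^+ 2)) =
    fun y => ((-1) ^+ k * hermite_pol k).[y] * expR (-1 * y ^+ 2).
  elim: k => [|k IH]; first by apply/funext => y; rewrite expr0 mul1r hornerC mul1r mulN1r.
  rewrite derive1nS IH; apply/funext => y; rewrite derive1E.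
  rewrite (@derive_val _ _ _ _ _ _ _ (is_derive_gauss (-1) _ y)).
  congr (_.[_] * _).
  rewrite exprS (_ : (-1) ^+ k = ((-1) ^+ k)%:P :> {poly R}); last by rewrite rmorphXn rmorphN1.
  rewrite derivM derivC /= polyCM rmorphN1; ring.
rewrite /hermite_poly H hornerM mulN1r expRN.
have -> : ((-1) ^+ n : {poly R}).[x] = (-1) ^+ n.
  by rewrite horner_exp hornerN hornerC.
have ss : (-1) ^+ n * (-1) ^+ n = 1 :> R by rewrite -expr2 sqrr_sign.
transitivity ((-1) ^+ n * (-1) ^+ n * (hermite_pol n).[x]); last by rewrite ss mul1r.
by field; rewrite gt_eqF// expR_gt0.
Qed.

Lemma horner_bound (p : {poly R}) :
  exists C k, 0 <= C /\ forall x, `|p.[x]| <= C * (1 + x ^+ 2) ^+ k.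
Proof.
elim/poly_ind: p => [|p c [C [k [C0 IH]]]].
  by exists 0, 0%N; split => // x; rewrite horner0 normr0 mul0r.
exists (C + `|c|), k.+1; split=> [|x]; first by rewrite addr_ge0.
have x1 : 1 <= 1 + x ^+ 2 by rewrite lerDl sqr_ge0.
rewrite hornerD hornerC hornerM hornerX (le_trans (ler_normD _ _))// mulrDl lerD//.
  rewrite normrM exprSr mulrA ler_pM//.
  have := sqr_ge0 (`|x| - 1); rewrite sqrrB1 real_normK ?num_real// => h.
  have := normr_ge0 x; have := sqr_ge0 x; nra.
by rewrite ler_peMr// exprn_ege1.
Qed.

(** With [y = x^2 / (k + 1)], this is the power [k + 1] of [1 + (k + 1) y <= (k + 1) e^y]. *)
Lemma oneDsqr_exp_le (k : nat) (x : R) :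
  (1 + x ^+ 2) ^+ k.+1 <= k.+1%:R ^+ k.+1 * expR (x ^+ 2).
Proof.
have k0 : 0 < k.+1%:R :> R by rewrite ltr0n.
have k1 : 1 <= k.+1%:R :> R by rewrite ler1n.
have -> : x ^+ 2 = k.+1%:R * (x ^+ 2 / k.+1%:R) by rewrite mulrC divfK// gt_eqF.
set y := x ^+ 2 / _.
have y0 : 0 <= y by rewrite divr_ge0 ?sqr_ge0.
rewrite expRM_natl -exprMn.
have le1 : 1 + k.+1%:R * y <= k.+1%:R * expR y.
  apply: (@le_trans _ _ (k.+1%:R * (1 + y))).
    by move: (k.+1%:R) k1 y0 => K; nra.
  by rewrite ler_pM2l// expR_ge1Dx.
have ge0 : 0 <= 1 + k.+1%:R * y by rewrite addr_ge0// mulr_ge0.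
by apply: lerXn2r le1; rewrite nnegrE// mulr_ge0 ?expR_ge0.
Qed.

Lemma gauss_poly_bound (p : {poly R}) :
  exists C, forall x, `|p.[x] * expR (- 1 * x ^+ 2)| <= C * (oneDsqr x)^-1.
Proof.
have [C [k [C0 Hp]]] := horner_bound p.
exists (C * k.+1%:R ^+ k.+1) => x.
rewrite mulN1r expRN normrM normfV (ger0_norm (expR_ge0 _)).
rewrite ler_pdivlMr ?(lt_le_trans ltr01)// mulrAC ler_pdivrMr ?expR_gt0//.
apply: (@le_trans _ _ (C * (1 + x ^+ 2) ^+ k.+1)).
  by rewrite exprSr mulrA ler_wpM2r// addr_ge0 ?sqr_ge0.
by rewrite -mulrA ler_wpM2l// oneDsqr_exp_le.
Qed.

Lemma continuous_gauss_poly (a : R) (p : {poly R}) :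
  continuous (fun x : R => p.[x] * expR (a * x ^+ 2)).
Proof.
move=> x; apply: differentiable_continuous; apply/derivable1_diffP.
exact: (@ex_derive _ _ _ _ _ _ _ (is_derive_gauss a p x)).
Qed.

Lemma integrable_gauss_poly (p : {poly R}) :
  mu.-integrable setT (fun x => (p.[x] * expR (- 1 * x ^+ 2))%:E).
Proof.
have [C HC] := gauss_poly_bound p.
apply: integrable_le_oneDsqrV HC.
by apply: continuous_measurable_fun; exact: continuous_gauss_poly.
Qed.
End hermite_polynomials.

(** * Gaussian integrals of Hermite polynomials *)

Section hermite_norms.
Context {R : realType}.
Local Notation mu := (@lebesgue_measure R).
Local Notation rT := (measurableTypeR R).

(** Dominated convergence along the intervals [[-n, n]], whose boundary terms tend to zero by the
    decay of [F]. *)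
Lemma integral_is_derive_line (f F : R -> R) (C : R) :
  (forall x : R, is_derive x (1 : R) F (f x)) -> continuous f ->
  mu.-integrable setT (EFin \o f) ->
  (forall x, `|F x| <= C * (oneDsqr x)^-1) -> \int[mu]_x f x = 0.
Proof.
move=> dF cf intf FC.
have mf : measurable_fun setT f by exact: continuous_measurable_fun.
pose D n : set rT := `[(- n%:R), n%:R]%classic.
have [||||| _ _ H] := @dominated_convergence _ rT R mu setT measurableT
    (fun n => (EFin \o f) \_ (D n)) (EFin \o f) (fun x : rT => `|f x|%:E).
- move=> n; apply/(measurable_restrictT _ _).1 => //; first exact: measurable_itv.
  by apply: measurable_funTS; exact/measurable_EFinP.
- exact/measurable_EFinP.
- apply: aeW => x _; apply: cvg_near_cst; near=> n.
  rewrite patchE mem_set// /D /= in_itv/= -ler_norml.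
  by near: n; exact: nbhs_infty_ger.
- exact: integrable_norm.
- apply: aeW => x n _ ; rewrite patchE; case: ifPn => _ //=.
  by rewrite normr0 lee_fin.
have FE n : (\int[mu]_x ((EFin \o f) \_ (D n)) x)%E = (F n%:R - F (- n%:R))%:E.
  rewrite -integral_mkcond /D (integral_is_derive _ dF)//.
  by rewrite (@le_trans _ _ 0)// oppr_le0.
have {}H : (F n%:R - F (- n%:R))%:E @[n --> \oo] --> (\int[mu]_x (f x)%:E)%E.
  by under eq_fun do rewrite -FE.
have F0 : (F n%:R - F (- n%:R)) @[n --> \oo] --> (0 : R).
  apply/cvgr0Pnorm_le => e e0; near=> n.
  have nE : n.+1%:R^-1 <= e / (2 * `|C| + 1).
    apply: ltW; near: n.
    have p0 : 0 < e / (2 * `|C| + 1) by rewrite divr_gt0// ltr_wpDl// mulr_ge0.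
    exact: (near_infty_natSinv_lt (PosNum p0)).
  have n1 : (oneDsqr (n%:R : R))^-1 <= n.+1%:R^-1.
    rewrite lef_pV2 ?posrE ?ltr0n ?(lt_le_trans ltr01)// /oneDsqr -natr1 addrC lerD2l.
    by rewrite -natrX ler_nat; case: (n) => // k; rewrite expnS expn1 leq_pmulr.
  have Fn (x : R) : oneDsqr x = oneDsqr n%:R -> `|F x| <= `|C| * n.+1%:R^-1.
    move=> E; apply: le_trans (FC x) _; rewrite E.
    apply: (@le_trans _ _ (`|C| * (oneDsqr (n%:R : R))^-1)).
      by rewrite ler_wpM2r ?invr_ge0// ler_norm.
    by rewrite ler_wpM2l.
  have F1 := Fn n%:R erefl.
  have F2 : `|F (- n%:R)| <= `|C| * n.+1%:R^-1 by apply: Fn; rewrite /oneDsqr sqrrN.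
  apply: (le_trans (ler_normB _ _)); apply: (le_trans (lerD F1 F2)).
  have C0 : 0 < 2 * `|C| + 1 by rewrite ltr_wpDl// mulr_ge0.
  have := ler_wpM2l (ltW C0) nE; rewrite mulrCA divff ?gt_eqF// mulr1.
  have : 0 <= n.+1%:R^-1 :> R by rewrite invr_ge0.
  move: (n.+1%:R^-1) (`|C|) => u v; nra.
rewrite /Rintegral.
have E0 : (F n%:R - F (- n%:R))%:E @[n --> \oo] --> (0 : R)%:E.
  by apply: cvg_EFin => //; exact: nearW.
by rewrite (cvg_unique _ H E0).
Unshelve. all: by end_near. Qed.

Definition gauss_int (p : {poly R}) : R := \int[mu]_x (p.[x] * expR (- 1 * x ^+ 2)).

Lemma gauss_int_deriv (p : {poly R}) : gauss_int (p^`() - 2 * 'X * p) = 0.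
Proof.
have [C HC] := gauss_poly_bound p.
rewrite /gauss_int (_ : p^`() - _ = p^`() + (2 * - 1)%:P * 'X * p); last first.
  by rewrite polyCM polyCN; ring.
apply: (integral_is_derive_line (F := fun x => p.[x] * expR (- 1 * x ^+ 2))) HC.
- exact: is_derive_gauss.
- exact: continuous_gauss_poly.
- exact: integrable_gauss_poly.
Qed.

Lemma gauss_intB p q : gauss_int (p - q) = gauss_int p - gauss_int q.
Proof.
rewrite /gauss_int -RintegralB//; try exact: integrable_gauss_poly.
by congr fine; apply: eq_integral => x _; rewrite hornerD hornerN mulrBl.
Qed.

Lemma gauss_int_natM m p : gauss_int (m%:R * p) = m%:R * gauss_int p.
Proof.
rewrite /gauss_int -RintegralZl//; last exact: integrable_gauss_poly.
congr fine; apply: eq_integral => x _.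
by rewrite -polyC_natr hornerM hornerC -[in LHS]mulrA.
Qed.

(** The difference of the two integrands is [p' - 2 x p] for [p = H_n H_(n+1)], which integrates to
    zero against the Gaussian. *)
Lemma gauss_int_hermite_sqS n :
  gauss_int (hermite_pol n.+1 ^+ 2) = (2 * n.+1)%:R * gauss_int (hermite_pol n ^+ 2).
Proof.
apply/esym/eqP; rewrite -subr_eq0 -gauss_int_natM -gauss_intB.
rewrite -[X in _ == X](gauss_int_deriv (hermite_pol n * hermite_pol n.+1)).
apply/eqP; congr gauss_int.
rewrite derivM deriv_hermite_pol.
rewrite (_ : hermite_pol n.+1 = 2 * 'X * hermite_pol n - (hermite_pol n)^`())//; ring.
Qed.

Lemma gauss_int_hermite_sq n :
  gauss_int (hermite_pol n ^+ 2) = 2 ^+ n * Num.sqrt pi * (n`!)%:R.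
Proof.
elim: n => [|n IH].
  rewrite expr0 mul1r mulr1 expr1n /gauss_int /Rintegral.
  rewrite -[RHS]/(fine (Num.sqrt pi)%:E) -integralT_gauss; congr fine.
  by apply: eq_integral => x _; rewrite hornerC mul1r mulN1r.
by rewrite gauss_int_hermite_sqS IH factS !natrM exprS; ring.
Qed.

Lemma gauss_int_hermite_deriv_sq n :
  gauss_int ((hermite_pol n)^`() ^+ 2) = (2 * n)%:R * gauss_int (hermite_pol n ^+ 2).
Proof.
case: n => [|n].
  rewrite derivC muln0 mul0r expr0n /= -[X in gauss_int X](mul0r 1).
  by rewrite (gauss_int_natM 0) mul0r.
rewrite deriv_hermite_pol exprMn -natrX gauss_int_natM gauss_int_hermite_sqS mulrA.
by rewrite -natrM mulnn.
Qed.
End hermite_norms.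

(** * Pointwise bound for oscillator solutions in the bulk *)

Section oscillator_bound.
Context {R : realType}.
Local Notation mu := (@lebesgue_measure R).

Lemma is_derive_ge0_le (f df : R -> R) (a b : R) : a <= b ->
  (forall x : R, is_derive x (1 : R) f (df x)) ->
  (forall x, a <= x <= b -> 0 <= df x) -> f a <= f b.
Proof.
move=> ab dfE df0.
have derf x : derivable f x 1 by exact: (@ex_derive _ _ _ _ _ _ _ (dfE x)).
apply: (@ger0_derive1_le_cc _ f a b) => //.
- move=> x; rewrite in_itv/= => /andP[ax xb].
  rewrite derive1E (@derive_val _ _ _ _ _ _ _ (dfE x)).
  by apply: df0; rewrite !ltW.
- apply: continuous_subspaceT => x; apply: differentiable_continuous.
  exact/derivable1_diffP.
- by rewrite in_itv/= lexx.
- by rewrite in_itv/= lexx ab.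
Qed.

(* The energy [F = v^2 + (U^2 - x^2) u^2] of a solution of the oscillator
   equation [u'' = (x^2 - U^2) u] is maximal at [0], and stays comparable to
   [F 0] on [[0, U/2]]; integrating it there bounds [F 0]. *)
Variables (u v : R -> R) (U : R).
Hypotheses (U0 : 0 < U)
  (du : forall x : R, is_derive x (1 : R) u (v x))
  (dv : forall x : R, is_derive x (1 : R) v ((x ^+ 2 - U ^+ 2) * u x))
  (iu : (\int[mu]_x (u x ^+ 2)%:E <= 1)%E)
  (iv : (\int[mu]_x (v x ^+ 2)%:E <= (U ^+ 2)%:E)%E).

Let F x := v x ^+ 2 + (U ^+ 2 - x ^+ 2) * u x ^+ 2.

Let dF (x : R) : is_derive x (1 : R) F (- (2 * x * u x ^+ 2)).
Proof. by rewrite /F; apply: is_derive_eq; rewrite /GRing.scale /=; ring. Qed.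

Let F_le_F0 x : F x <= F 0.
Proof.
have [x0|/ltW x0] := leP 0 x.
  have dN (y : R) : is_derive y (1 : R) (fun z => - F z) (2 * y * u y ^+ 2).
    by have := is_deriveN (dF y); rewrite opprK.
  have := is_derive_ge0_le x0 dN; rewrite lerN2; apply.
  by move=> y /andP[y0 _]; rewrite mulr_ge0 ?sqr_ge0// mulr_ge0.
apply: (is_derive_ge0_le x0 dF) => y /andP[_ y0].
by have := sqr_ge0 (u y); nra.
Qed.

(** In this range [U^2 - x^2 >= 3 U^2 / 4], so [F x <= F 0] controls [u x] itself. *)
Let u_le x : x ^+ 2 <= U ^+ 2 / 4 -> u x ^+ 2 <= 4 / 3 * F 0 / U ^+ 2.
Proof.
move=> xU; rewrite ler_pdivlMr ?exprn_gt0//.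
have := F_le_F0 x; rewrite /F.
have := sqr_ge0 (v x); have := sqr_ge0 (u x); have := sqr_ge0 (v 0).
nra.
Qed.

Let F_ge x : 0 <= x <= U / 2 -> 2 / 3 * F 0 <= F x.
Proof.
move=> /andP[x0 xU].
(* The derivative of [F] is [- 2 y u^2]; the added square compensates the largest decrease that
   [u_le] permits, so [G] is nondecreasing. Up to [U / 2] the compensation is at most [F 0 / 3]. *)
pose G y := F y + (4 / 3 * F 0 / U ^+ 2) * y ^+ 2.
have dG (y : R) : is_derive y (1 : R) G
    (- (2 * y * u y ^+ 2) + (4 / 3 * F 0 / U ^+ 2) * (2 * y)).
  by rewrite /G; apply: is_derive_eq; rewrite /GRing.scale /=; ring.
have : G 0 <= G x.
  apply: (is_derive_ge0_le x0 dG) => y /andP[y0 yx].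
  have yU : y ^+ 2 <= U ^+ 2 / 4 by nra.
  have := u_le yU; set w := 4 / 3 * F 0 / U ^+ 2; nra.
rewrite /G expr0n /= mulr0 addr0.
have x2 : x ^+ 2 <= U ^+ 2 / 4 by nra.
have F00 : 0 <= F 0.
  rewrite /F expr0n /= subr0; apply: addr_ge0; first exact: sqr_ge0.
  by apply: mulr_ge0; exact: sqr_ge0.
have : 4 / 3 * F 0 / U ^+ 2 * x ^+ 2 <= F 0 / 3.
  rewrite mulrAC ler_pdivrMr ?exprn_gt0//; nra.
lra.
Qed.

Lemma oscillator_sup_le x : x ^+ 2 <= U ^+ 2 / 4 -> u x ^+ 2 <= 8 / U.
Proof.
move=> xU; apply: le_trans (u_le xU) _.
(* Over [[0, U / 2]] the lower bound [2 / 3 * F 0] integrates to [U * F 0 / 3], while the integral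
   of [v^2 + U^2 u^2] is at most [2 U^2]. The [8] of the statement is [4 / 3] times [6]. *)
suff F06 : F 0 <= 6 * U.
  rewrite ler_pdivrMr ?exprn_gt0// (_ : 8 / U * U ^+ 2 = 8 * U); first by lra.
  by field; rewrite gt_eqF.
have cu : continuous u.
  move=> y; apply: differentiable_continuous; apply/derivable1_diffP.
  exact: (@ex_derive _ _ _ _ _ _ _ (du y)).
have cv : continuous v.
  move=> y; apply: differentiable_continuous; apply/derivable1_diffP.
  exact: (@ex_derive _ _ _ _ _ _ _ (dv y)).
have mu2 : measurable_fun setT (fun x => (u x ^+ 2)%:E).
  by apply/measurable_EFinP/measurable_funX; exact: continuous_measurable_fun.
have mv2 : measurable_fun setT (fun x => (v x ^+ 2)%:E).
  by apply/measurable_EFinP/measurable_funX; exact: continuous_measurable_fun.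
have F00 : 0 <= 2 / 3 * F 0.
  apply: mulr_ge0 => //; rewrite /F expr0n /= subr0; apply: addr_ge0.
    exact: sqr_ge0.
  by apply: mulr_ge0; exact: sqr_ge0.
have : ((2 / 3 * F 0)%:E * (U / 2)%:E <= (U ^+ 2 + U ^+ 2)%:E)%E.
  apply: (@le_trans _ _ (\int[mu]_(x in `[0%R, (U / 2)%R]) (2 / 3 * F 0)%:E)%E).
    rewrite integral_cst//= lebesgue_measure_itv /= lte_fin divr_gt0//.
    by rewrite oppr0 adde0.
  apply: (@le_trans _ _ (\int[mu]_x ((v x ^+ 2)%:E + (U ^+ 2)%:E * (u x ^+ 2)%:E))%E).
    rewrite integral_mkcond; apply: ge0_le_integral_nomeas => y _.
      by rewrite patchE; case: ifPn.
    rewrite patchE; case: ifPn => [|_]; last first.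
      by rewrite adde_ge0// ?mule_ge0// lee_fin sqr_ge0.
    rewrite inE /= in_itv /= => /F_ge h; rewrite -EFinM -EFinD lee_fin.
    apply: le_trans h _; rewrite /F lerD2l ler_wpM2r ?sqr_ge0//.
    by rewrite lerBlDr lerDl sqr_ge0.
  rewrite ge0_integralDT//; last 3 first.
  - exact: measurable_funeM.
  - by move=> y; rewrite lee_fin sqr_ge0.
  - by move=> y; rewrite -EFinM lee_fin mulr_ge0 ?sqr_ge0.
  rewrite ge0_integralZl_real ?sqr_ge0//; last by move=> y; rewrite lee_fin sqr_ge0.
  rewrite [leRHS]EFinD leeD// -[leRHS]mule1.
  by apply: lee_wpmul2l; rewrite ?lee_fin ?sqr_ge0.
rewrite -EFinM lee_fin => h; rewrite -(ler_pM2r U0); move: (F 0) h => f h; lra.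
Qed.
End oscillator_bound.

(** * The weight and the integral of its inverse *)

Section weight.
Context {R : realType}.
Local Notation mu := (@lebesgue_measure R).

Definition quartic_weight (c x : R) : R := Num.sqrt (Num.sqrt (1 + c * x ^+ 2)).

(* [inv_weight U t = (U + t)^2 / (U t)]: its inverse is the weight [w_alpha],
   with [U = sqrt (2 alpha + 1)] and [t = (1 + nu x^2)^(1/4)]. *)
Definition inv_weight (U t : R) : R := U / t + 2 + t / U.

Section quartic_weight_theory.
Variables (c : R).
Hypothesis c0 : 0 <= c.

Let s1 x : 1 <= 1 + c * x ^+ 2.
Proof. by rewrite lerDl mulr_ge0 ?sqr_ge0. Qed.

Lemma quartic_weight_gt0 x : 0 < quartic_weight c x.
Proof. by rewrite !sqrtr_gt0 (lt_le_trans ltr01). Qed.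

Lemma quartic_weight_exp4 x : quartic_weight c x ^+ 4 = 1 + c * x ^+ 2.
Proof.
rewrite (exprM _ 2 2) !sqr_sqrtr ?sqrtr_ge0//.
exact: le_trans ler01 (s1 x).
Qed.

Lemma is_derive_quartic_weight (x : R) :
  is_derive x (1 : R) (quartic_weight c) (c * x / (2 * quartic_weight c x ^+ 3)).
Proof.
have t0 := quartic_weight_gt0 x.
have s0 : 0 < 1 + c * x ^+ 2 := lt_le_trans ltr01 (s1 x).
have q0 : 0 < Num.sqrt (1 + c * x ^+ 2) by rewrite sqrtr_gt0.
have d1 : is_derive x (1 : R) (fun y : R => 1 + c * y ^+ 2) (2 * c * x).
  by apply: is_derive_eq; rewrite /GRing.scale /=; ring.
have d2 : is_derive x (1 : R) (Num.sqrt \o (fun y : R => 1 + c * y ^+ 2))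
    ((2 * Num.sqrt (1 + c * x ^+ 2))^-1 * (2 * c * x)).
  by apply: is_derive1_comp; exact: is_derive1_sqrt.
have d3 : is_derive x (1 : R) (Num.sqrt \o (Num.sqrt \o (fun y : R => 1 + c * y ^+ 2)))
    ((2 * Num.sqrt (Num.sqrt (1 + c * x ^+ 2)))^-1 *
     ((2 * Num.sqrt (1 + c * x ^+ 2))^-1 * (2 * c * x))).
  by apply: is_derive1_comp; exact: is_derive1_sqrt.
apply: is_derive_eq.
rewrite -/(quartic_weight c x) in t0 *.
have -> : Num.sqrt (1 + c * x ^+ 2) = quartic_weight c x ^+ 2.
  by rewrite sqr_sqrtr// sqrtr_ge0.
by field; rewrite gt_eqF.
Qed.

Lemma continuous_quartic_weight : continuous (quartic_weight c).
Proof.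
move=> x; apply: differentiable_continuous; apply/derivable1_diffP.
exact: (@ex_derive _ _ _ _ _ _ _ (is_derive_quartic_weight x)).
Qed.

Lemma continuous_quartic_weightV : continuous (fun x => (quartic_weight c x)^-1).
Proof.
move=> x; apply: cvgV; first by rewrite gt_eqF// quartic_weight_gt0.
exact: continuous_quartic_weight.
Qed.

(** For large [|x|], [t] behaves like a multiple of [sqrt |x|], which makes [2 x / t] an approximate
    antiderivative of [1 / t]. Its exact derivative [(2 + c x^2) / t^5] exceeds [t^4 / t^5]. *)
Lemma integral_quartic_weightV_le (h : R) : 0 <= h ->
  (\int[mu]_(x in `[(- h)%R, h]) ((quartic_weight c x)^-1)%:E <=
   (4 * h / quartic_weight c h)%:E)%E.
Proof.
move=> h0; set t := quartic_weight c.
pose f x := (2 + c * x ^+ 2) / t x ^+ 5.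
have dF (x : R) : is_derive x (1 : R) (fun y => 2 * y * (t y)^-1) (f x).
  have tx0 : t x != 0 by rewrite gt_eqF// quartic_weight_gt0.
  have dt := is_derive_quartic_weight x.
  have dV : is_derive x (1 : R) (fun y => (t y)^-1)
      (- (t x) ^- 2 * (c * x / (2 * t x ^+ 3))).
    apply: DeriveDef; first by apply: derivableV => //; exact: ex_derive.
    by rewrite deriveV//; congr (_ *: _); exact: derive_val.
  have d2 : is_derive x (1 : R) (fun y => 2 * y) 2.
    by apply: is_derive_eq; rewrite /GRing.scale /=; ring.
  have := is_deriveM d2 dV; congr (is_derive _ _ _ _).
  rewrite /GRing.scale /= /f.
  transitivity ((2 * t x ^+ 4 - c * x ^+ 2) / t x ^+ 5); first by field.
  by rewrite quartic_weight_exp4; congr (_ / _); ring.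
have cf : continuous f.
  move=> x; apply: cvgM.
    apply: cvgD; first exact: cvg_cst.
    by apply: cvgM; [exact: cvg_cst|exact: exprn_continuous].
  apply: cvgV; first by rewrite expf_neq0// gt_eqF// quartic_weight_gt0.
  apply: (@continuous_comp _ _ _ t (fun y => y ^+ 5)).
    exact: continuous_quartic_weight.
  exact: exprn_continuous.
apply: (@le_trans _ _ (\int[mu]_(x in `[(- h)%R, h]) (f x)%:E)%E).
  apply: ge0_le_integral_nomeas => x _.
    by rewrite lee_fin invr_ge0 ltW// quartic_weight_gt0.
  have t0 := quartic_weight_gt0 x; have t4 := quartic_weight_exp4 x.
  rewrite lee_fin /f ler_pdivlMr ?exprn_gt0// exprS mulrA mulVf ?gt_eqF// mul1r t4.
  by rewrite lerD2r ler1n.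
rewrite (integral_is_derive _ dF cf); last by lra.
by rewrite lee_fin /t {2}/quartic_weight sqrrN -/(quartic_weight c h); lra.
Qed.
End quartic_weight_theory.
End weight.

Section weighted_norm.
Context {R : realType}.
Local Notation mu := (@lebesgue_measure R).

(** The three terms of [inv_weight] are treated separately. For [t / U], the fourth power gives
    [t / U <= 2 + x^2 / U^2]. For [U / t], the pointwise bound yields [8 / t] when [|x| <= U / 2],
    and [t >= U / 2] yields [2] outside. Altogether [39 = 6 + 1 + 8 * 4]: mass, second moment, and
    the integral of [1 / t] over the bulk. *)
Lemma inv_weight_integral_le (u : R -> R) (U : R) : 1 <= U -> continuous u ->
  (\int[mu]_x (u x ^+ 2)%:E <= 1)%E ->
  (\int[mu]_x (x ^+ 2 * u x ^+ 2)%:E <= (U ^+ 2)%:E)%E ->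
  (forall x : R, x ^+ 2 <= U ^+ 2 / 4 -> u x ^+ 2 <= 8 / U) ->
  (\int[mu]_x (u x ^+ 2 * inv_weight U (quartic_weight (U ^+ 2) x))%:E <= 39%:E)%E.
Proof.
move=> U1 cu iu ixu usup.
have U0 : 0 < U by rewrite (lt_le_trans ltr01).
have c0 : 0 <= U ^+ 2 by rewrite sqr_ge0.
set t := quartic_weight (U ^+ 2).
have t0 x : 0 < t x by exact: quartic_weight_gt0.
have t4 x : t x ^+ 4 = 1 + U ^+ 2 * x ^+ 2 by exact: quartic_weight_exp4.
pose D : set R := `[(- (U / 2)), (U / 2)]%classic.
have mu2 : measurable_fun setT (fun x : R => (u x ^+ 2)%:E).
  by apply/measurable_EFinP/measurable_funX; exact: continuous_measurable_fun.
have mx2 : measurable_fun setT (fun x : R => (x ^+ 2 * u x ^+ 2)%:E).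
  apply/measurable_EFinP; apply: measurable_funM; first exact: measurable_funX.
  by apply: measurable_funX; exact: continuous_measurable_fun.
have mt : measurable_fun setT (fun x => (t x)^-1).
  by apply: continuous_measurable_fun; exact: continuous_quartic_weightV.
pose V (x : R) : R := (t x)^-1 * \1_D x.
have V0 x : 0 <= V x by rewrite mulr_ge0 ?invr_ge0 ?(ltW (t0 x)).
have mD : measurable D by exact: measurable_itv.
have mV : measurable_fun setT (fun x => (V x)%:E).
  by apply/measurable_EFinP; apply: measurable_funM => //; exact: measurable_indic.
have u20 x : (0 <= (u x ^+ 2)%:E)%E by rewrite lee_fin sqr_ge0.
have x20 x : (0 <= (x ^+ 2 * u x ^+ 2)%:E)%E by rewrite lee_fin mulr_ge0 ?sqr_ge0.
apply: (@le_trans _ _ (\int[mu]_x (6%:E * (u x ^+ 2)%:E +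
   (((U ^- 2)%:E * (x ^+ 2 * u x ^+ 2)%:E) + 8%:E * (V x)%:E)))%E).
  apply: ge0_le_integral_nomeas => x _.
    by rewrite lee_fin mulr_ge0 ?sqr_ge0// !addr_ge0 ?divr_ge0// ltW.
  have t0x := t0 x; have t4x := t4 x.
  have h1 : t x / U <= 2 + x ^+ 2 / U ^+ 2.
    have : t x / U <= 1 + (t x / U) ^+ 4.
      have : 0 <= t x / U by rewrite divr_ge0 ?ltW.
      move: (t x / U) => z z0; have [z1|z1] := leP z 1.
        have := exprn_ge0 4 z0; lra.
      by rewrite (@le_trans _ _ (z ^+ 4)) ?ler_eXnr ?lerDr// ltW.
    move=> /le_trans; apply; rewrite expr_div_n t4x.
    have -> : (1 + U ^+ 2 * x ^+ 2) / U ^+ 4 = U ^- 4 + x ^+ 2 / U ^+ 2.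
      by field; rewrite gt_eqF.
    have : U ^- 4 <= 1 by rewrite invf_le1 ?exprn_gt0// exprn_ege1.
    lra.
  have h2 : u x ^+ 2 * (U / t x) <= 2 * u x ^+ 2 + 8 * V x.
    rewrite /V indicE; case: (boolP (x \in D)) => [|xD].
      rewrite inE /D /= in_itv/= => /andP[x1 x2].
      have x2U : x ^+ 2 <= U ^+ 2 / 4 by nra.
      have := ler_wpM2r (ltW (divr_gt0 U0 t0x)) (usup _ x2U).
      rewrite (_ : 8 / U * (U / t x) = 8 * (t x)^-1); last by field; rewrite !gt_eqF.
      by rewrite mulr1; have := sqr_ge0 (u x); lra.
    rewrite !mulr0 addr0 mulrC ler_wpM2r ?sqr_ge0//.
    rewrite ler_pdivrMr//.
    have xU : (U / 2) ^+ 2 <= x ^+ 2.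
      rewrite leNgt; apply/negP => h; move/negP: xD; apply.
      rewrite inE /D /= in_itv/= -ler_norml ltW// -(@ltr_pXn2r _ 2)// ?nnegrE ?divr_ge0//; last first.
        exact: ltW.
      by rewrite real_normK ?num_real.
    have : (U / 2) ^+ 4 <= t x ^+ 4.
      rewrite t4x; have := ler_wpM2l c0 xU; rewrite (exprM _ 2 2).
      have := sqr_ge0 U; set w := U ^+ 2.
      rewrite expr_div_n -/w; nra.
    by rewrite ler_pXn2r ?nnegrE ?divr_ge0 ?(ltW U0) ?(ltW t0x)//; lra.
  have h3 := ler_wpM2l (sqr_ge0 (u x)) h1.
  rewrite -!EFinM -!EFinD lee_fin /inv_weight !mulrDr.
  have -> : U ^- 2 * (x ^+ 2 * u x ^+ 2) = u x ^+ 2 * (x ^+ 2 / U ^+ 2) by ring.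
  rewrite mulrDr in h3; lra.
have iV : (\int[mu]_x (V x)%:E <= 4%:E)%E.
  have := @integral_quartic_weightV_le R (U ^+ 2) c0 (U / 2).
  rewrite divr_ge0 ?(ltW U0)// => /(_ isT); rewrite -/t -/D => h.
  apply: (@le_trans _ _ (4 * (U / 2) / t (U / 2))%:E).
    apply: le_trans h; rewrite [leRHS]integral_mkcond le_eqVlt; apply/orP; left.
    apply/eqP; apply: eq_integral => x _; rewrite patchE /V indicE.
    by case: ifPn; rewrite ?mulr1 ?mulr0.
  rewrite lee_fin ler_pdivrMr//.
  have : (U / 2) ^+ 4 <= t (U / 2) ^+ 4.
    rewrite t4 (exprM _ 2 2) expr_div_n; have := sqr_ge0 U; set w := U ^+ 2.
    by nra.
  by rewrite ler_pXn2r ?nnegrE ?divr_ge0 ?(ltW U0) ?(ltW (t0 _))//; lra.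
have U20 : 0 <= U ^- 2 by rewrite invr_ge0 sqr_ge0.
have m1 : measurable_fun setT (fun x : R => 6%:E * (u x ^+ 2)%:E)%E.
  exact: measurable_funeM.
have m2 : measurable_fun setT (fun x : R => (U ^- 2)%:E * (x ^+ 2 * u x ^+ 2)%:E)%E.
  exact: measurable_funeM.
have m3 : measurable_fun setT (fun x : R => 8%:E * (V x)%:E)%E.
  exact: measurable_funeM.
have p1 x : (0 <= 6%:E * (u x ^+ 2)%:E :> \bar R)%E by rewrite mule_ge0// lee_fin.
have p2 (x : R) : (0 <= (U ^- 2)%:E * (x ^+ 2 * u x ^+ 2)%:E)%E by rewrite mule_ge0// lee_fin.
have p3 x : (0 <= 8%:E * (V x)%:E :> \bar R)%E by rewrite mule_ge0// lee_fin.
rewrite ge0_integralDT//; last 2 first.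
- exact: emeasurable_funD.
- by move=> x; rewrite adde_ge0.
rewrite ge0_integralDT// !ge0_integralZl_real//.
rewrite (_ : 39%:E = 6%:E * 1%:E + ((U ^- 2)%:E * (U ^+ 2)%:E + 8%:E * 4%:E))%E; last first.
  rewrite -!EFinM -!EFinD mulVf ?expf_neq0 ?gt_eqF//; congr EFin; ring.
by apply: leeD; [exact: lee_wpmul2l|apply: leeD; apply: lee_wpmul2l].
Qed.
End weighted_norm.

(** * Weighted norms of the scaled Hermite functions *)

Section hermite_weighted_norm.
Context {R : realType}.
Local Notation mu := (@lebesgue_measure R).
Local Notation rT := (measurableTypeR R).
Variable n : nat.

Let U : R := Num.sqrt (2 * n + 1)%:R.
Let c : R := (2 ^+ n * Num.sqrt pi * (n`!)%:R) `^ (- 2^-1).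
Let P : {poly R} := c%:P * hermite_pol n.
Let E (x : R) : R := expR (- 2^-1 * x ^+ 2).

Let U2 : U ^+ 2 = (2 * n + 1)%:R.
Proof. by rewrite sqr_sqrtr ?ler0n. Qed.

Let U1 : 1 <= U.
Proof. by rewrite -[leLHS]sqrtr1 ler_wsqrtr// ler1n addn1. Qed.

Lemma hermite_funE x : hermite_fun n x = P.[x] * E x.
Proof.
rewrite /hermite_fun hermite_polyE /P hornerM hornerC /E.
by congr (_ * expR _); rewrite mulNr mulNr mulrC.
Qed.

Let c2 : c ^+ 2 * (2 ^+ n * Num.sqrt pi * (n`!)%:R) = 1.
Proof.
have z0 : 0 < 2 ^+ n * Num.sqrt pi * (n`!)%:R :> R.
  by rewrite !mulr_gt0 ?exprn_gt0 ?sqrtr_gt0 ?pi_gt0 ?ltr0n ?fact_gt0.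
rewrite /c -powR_mulrn ?powR_ge0// -powRrM mulNr mulVf// powRN powRr1 ?(ltW z0)//.
by rewrite mulVf// gt_eqF.
Qed.

Let E2 x : E x ^+ 2 = expR (-1 * x ^+ 2).
Proof. by rewrite /E expr2 -expRD; congr expR; field. Qed.

Let dhf : R -> R := fun x => (P^`() - 'X * P).[x] * E x.

Let P_deriv : P^`() = c%:P * (hermite_pol n)^`().
Proof. by rewrite /P derivM derivC mul0r add0r. Qed.

Let d1 (x : R) : is_derive x (1 : R) (hermite_fun n) (dhf x).
Proof.
rewrite (_ : hermite_fun n = fun x => P.[x] * E x); last exact/funext/hermite_funE.
rewrite /dhf (_ : _ - _ = P^`() + (2 * - 2^-1)%:P * 'X * P); last first.
  by rewrite mulrN divff// polyCN; ring.
exact: is_derive_gauss.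
Qed.

Let d2 (x : R) : is_derive x (1 : R) dhf ((x ^+ 2 - U ^+ 2) * hermite_fun n x).
Proof.
rewrite hermite_funE mulrA (_ : _ * P.[x] =
   ((P^`() - 'X * P)^`() + (2 * - 2^-1)%:P * 'X * (P^`() - 'X * P)).[x]).
  exact: is_derive_gauss.
have -> : (x ^+ 2 - U ^+ 2) * P.[x] = (('X ^+ 2 - (2 * n + 1)%:R) * P).[x].
  by rewrite U2 !hornerE -polyC_natr hornerC.
congr (_.[_]); rewrite mulrN divff// polyCN.
have dX : ('X * P)^`() = P + 'X * P^`() by rewrite derivM derivX mul1r.
rewrite derivB dX P_deriv derivM derivC mul0r add0r hermite_pol_ode /P natrD natrM; ring.
Qed.

Let int_sq (p : {poly R}) : (\int[mu]_x (p.[x] * expR (-1 * x ^+ 2))%:E = (gauss_int p)%:E)%E.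
Proof. by rewrite /gauss_int /Rintegral fineK// integrable_fin_num//; exact: integrable_gauss_poly. Qed.

Let gaussM (a : R) p : gauss_int (a%:P * p) = a * gauss_int p.
Proof.
rewrite /gauss_int -RintegralZl//; last exact: integrable_gauss_poly.
congr fine; apply: eq_integral => x _.
by rewrite hornerM hornerC -[in LHS]mulrA.
Qed.

Let gaussD p q : gauss_int (p + q) = gauss_int p + gauss_int q :> R.
Proof.
rewrite /gauss_int -RintegralD//; try exact: integrable_gauss_poly.
by congr fine; apply: eq_integral => x _; rewrite hornerD mulrDl.
Qed.

Lemma hermite_fun_norm : (\int[mu]_x (hermite_fun n x ^+ 2)%:E = 1)%E.
Proof.
under eq_integral => x _ do rewrite hermite_funE exprMn E2 -horner_exp.
rewrite int_sq /P exprMn -rmorphXn /= gaussM gauss_int_hermite_sq.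
by rewrite c2.
Qed.

(** Up to sign, [X P] and [P' - X P] are the half-sum and half-difference of [P'] and [2 X P - P'],
    that is of [c H_n'] and [c H_(n+1)]. Their squared norms are [2 n] and [2 (n + 1)], and half the
    sum is [2 n + 1]. Each summand is then at most [U^2], as the oscillator bound and the weighted
    estimate require. *)
Lemma hermite_fun_virial :
  (\int[mu]_x (x ^+ 2 * hermite_fun n x ^+ 2)%:E +
   \int[mu]_x (dhf x ^+ 2)%:E = (U ^+ 2)%:E)%E.
Proof.
rewrite (eq_integral (fun x : rT => ((('X * P) ^+ 2).[x] * expR (-1 * x ^+ 2))%:E)); last first.
  move=> x _; rewrite hermite_funE exprMn E2 mulrA; congr EFin; congr (_ * _).
  by rewrite horner_exp (hornerM 'X P) hornerX exprMn.
rewrite [X in (_ + X)%E](eq_integral (fun x : rT => (((P^`() - 'X * P) ^+ 2).[x] * expR (-1 * x ^+ 2))%:E)); last first.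
  by move=> x _; rewrite /dhf exprMn E2 horner_exp.
rewrite !int_sq -EFinD; congr EFin.
have E1 : gauss_int (('X * P) ^+ 2) + gauss_int ((P^`() - 'X * P) ^+ 2) =
  c ^+ 2 * (2^-1 * (gauss_int ((hermite_pol n)^`() ^+ 2) + gauss_int (hermite_pol n.+1 ^+ 2))).
  apply: (@mulfI _ 2) => //.
  have half S : 2 * (c ^+ 2 * (2^-1 * S)) = c ^+ 2 * S by field.
  rewrite half -!gaussD -gaussM -(gauss_int_natM 2).
  congr gauss_int; rewrite P_deriv rmorphXn /= /P.
  ring.
rewrite E1 gauss_int_hermite_sqS gauss_int_hermite_deriv_sq gauss_int_hermite_sq.
rewrite -mulrDl -natrD U2.
transitivity (c ^+ 2 * (2 ^+ n * Num.sqrt pi * (n`!)%:R) * (2 * n + 1)%:R); last first.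
  by rewrite c2 mul1r.
rewrite (_ : (2 * n + 2 * n.+1)%N = (2 * (2 * n + 1))%N); last first.
  by rewrite mulnS mulnDr muln1; ring.
by rewrite natrM; field.
Qed.

Lemma continuous_hermite_fun : continuous (hermite_fun n : R -> R).
Proof.
move=> x; apply: differentiable_continuous; apply/derivable1_diffP.
exact: (@ex_derive _ _ _ _ _ _ _ (d1 x)).
Qed.

Lemma measurable_scaled_hermite_fun (l : R) : measurable_fun setT (scaled_hermite_fun n l).
Proof.
apply: (@measurable_funM _ _ R) => //.
apply: (measurableT_comp (f := hermite_fun n)).
  by apply: continuous_measurable_fun; exact: continuous_hermite_fun.
by apply: (@measurable_funM _ _ R).
Qed.

Lemma hermite_fun_inv_weight :
  (\int[mu]_x (hermite_fun n x ^+ 2 *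
     inv_weight U (quartic_weight (U ^+ 2) x))%:E <= 39%:E)%E.
Proof.
have sq0 (f : R -> R) : (0 <= \int[mu]_x (f x ^+ 2)%:E)%E.
  by apply: integral_ge0 => x _; rewrite lee_fin sqr_ge0.
have xsq0 : (0 <= \int[mu]_x (x ^+ 2 * hermite_fun n x ^+ 2)%:E)%E.
  by apply: integral_ge0 => x _; rewrite lee_fin mulr_ge0 ?sqr_ge0.
apply: inv_weight_integral_le => //.
- exact: continuous_hermite_fun.
- by rewrite hermite_fun_norm.
- by rewrite -hermite_fun_virial leeDl.
- move=> x; apply: (oscillator_sup_le _ d1 d2).
  + exact: lt_le_trans ltr01 U1.
  + by rewrite hermite_fun_norm.
  + by rewrite -hermite_fun_virial leeDr.
Qed.

Lemma measurable_inv_weight (V c1 : R) : 0 <= c1 ->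
  measurable_fun setT (fun x => inv_weight V (quartic_weight c1 x)).
Proof.
move=> c10; apply: (@measurable_funD _ _ R); first apply: (@measurable_funD _ _ R) => //.
  apply: (@measurable_funM _ _ R) => //; apply: continuous_measurable_fun.
  exact: continuous_quartic_weightV.
apply: (@measurable_funM _ _ R) => //; apply: continuous_measurable_fun.
exact: continuous_quartic_weight.
Qed.

(** With [y = sqrt |l| x] one has [U^2 y^2 = (2 n + 1) |l| x^2 = nu x^2]. So the weight of the
    unscaled function becomes one that sees [l] only through [nu], and the constant is uniform in
    both [n] and [l]. *)
Lemma scaled_hermite_fun_inv_weight (l : R) : l != 0 ->
  (\int[mu]_x (scaled_hermite_fun n l x ^+ 2 *
     inv_weight U (quartic_weight ((2 * n + 1)%:R * `|l|) x))%:E <= 39%:E)%E.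
Proof.
move=> l0; have al0 : 0 < `|l| by rewrite normr_gt0.
set r := Num.sqrt `|l|; have r0 : 0 < r by rewrite sqrtr_gt0.
pose G (y : R) := (hermite_fun n y ^+ 2 * inv_weight U (quartic_weight (U ^+ 2) y))%:E.
have G0 y : (0 <= G y)%E.
  rewrite lee_fin mulr_ge0 ?sqr_ge0// !addr_ge0// divr_ge0 ?sqrtr_ge0//.
have mG : measurable_fun setT G.
  apply/measurable_EFinP; apply: measurable_funM.
    by apply: measurable_funX; apply: continuous_measurable_fun; exact: continuous_hermite_fun.
  by apply: measurable_inv_weight; rewrite sqr_ge0.
have := ge0_integral_affine 0 r0 mG G0 => H.
rewrite (eq_integral (fun x : rT => r%:E * G (r * x + 0)%R)%E); last first.
  move=> x _; rewrite addr0 /G -EFinM mulrA; congr (_ * inv_weight _ _)%:E.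
    rewrite /scaled_hermite_fun exprMn -/r; congr (_ * _).
    rewrite -powR_mulrn ?powR_ge0// -powRrM /r -powR12_sqrt//.
    by congr (_ `^ _); field.
  rewrite /quartic_weight U2; congr (Num.sqrt (Num.sqrt (1 + _))).
  by rewrite exprMn /r sqr_sqrtr// -mulrA.
rewrite ge0_integralZl_real ?(ltW r0)//; last first.
  by apply: (measurableT_comp mG); apply: (@measurable_funD _ _ R) => //.
rewrite H muleA -EFinM mulfV ?gt_eqF// mul1e.
exact: hermite_fun_inv_weight.
Qed.
End hermite_weighted_norm.

(** * The restriction estimate *)

Section preparation.
Context {R : realType}.
Local Notation mu := (@lebesgue_measure R).
Local Notation rT := (measurableTypeR R).

(* The summand is dominated by the increment of
   [alpha |-> sqrt (2 alpha + 1) / (sqrt (2 alpha + 1) + t)]. *)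
Lemma sum_inv_weight_le (t : R) (K : nat) : 0 < t ->
  \sum_(0 <= alpha < K) ((2 * alpha + 1)%:R^-1 *
     (inv_weight (Num.sqrt (2 * alpha + 1)%:R) t)^-1) <= 1.
Proof.
move=> t0; pose u (n : nat) : R := Num.sqrt (2 * n + 1)%:R.
have u0 n : 0 < u n by rewrite sqrtr_gt0 ltr0n addn1.
have u2 n : u n ^+ 2 = (2 * n + 1)%:R by rewrite sqr_sqrtr// ler0n.
have termE n : (2 * n + 1)%:R^-1 * (inv_weight (u n) t)^-1 =
    t / (u n * (u n + t) ^+ 2).
  have un := u0 n; rewrite -u2 /inv_weight; field.
  by rewrite !gt_eqF// ?addr_gt0// ?mulr_gt0// ?exprn_gt0//; nra.
suff H n : \sum_(0 <= alpha < n.+1) ((2 * alpha + 1)%:R^-1 *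
     (inv_weight (u alpha) t)^-1) <= u n / (u n + t).
  case: K => [|K]; first by rewrite big_geq.
  apply: le_trans (H K) _; rewrite ler_pdivrMr ?addr_gt0//.
  by rewrite mul1r lerDl ltW.
elim: n => [|n IH].
  rewrite big_nat1 termE; have un := u0 0%N.
  have u01 : u 0%N = 1 by rewrite /u muln0 add0n sqrtr1.
  rewrite u01 mul1r ler_pdivrMr ?exprn_gt0 ?addr_gt0//.
  rewrite mul1r expr2 mulrA mulVf ?gt_eqF ?addr_gt0// mul1r lerDr//.
rewrite big_nat_recr//= termE; apply: (le_trans (lerD IH (lexx _))).
have a0 := u0 n; have b0 := u0 n.+1.
have ab : u n.+1 ^+ 2 = u n ^+ 2 + 2 by rewrite !u2 mulnS -addnA addnC natrD.
move: (u n) (u n.+1) a0 b0 ab => a b a0 b0 ab.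
have lab : a <= b by nra.
have at0 : 0 < a + t by rewrite addr_gt0.
have bt0 : 0 < b + t by rewrite addr_gt0.
have -> : b / (b + t) = a / (a + t) + t * (b - a) / ((a + t) * (b + t)).
  by field; rewrite !gt_eqF.
rewrite lerD2l ler_pdivrMr ?mulr_gt0 ?exprn_gt0//.
have -> : t * (b - a) / ((a + t) * (b + t)) * (b * (b + t) ^+ 2) =
    t * ((b - a) * b * ((b + t) / (a + t))) by field; rewrite !gt_eqF.
rewrite ler_peMr ?(ltW t0)//.
have h1 : 1 <= (b + t) / (a + t) by rewrite ler_pdivlMr// mul1r lerD2r.
(* From [(b - a) (b + a) = 2] and [b + a <= 2 b]. *)
have h2 : 1 <= (b - a) * b by nra.
by rewrite -[leLHS]mulr1 ler_pM.
Qed.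

(** Both the positive and the negative part lie below [|f|], so either the right side is infinite or
    both parts have finite integrals. It is applied to the outer integrals of [hermite_fourier]. *)
Lemma normr_Rintegral_le_nomeas d (T : measurableType d) (m : {measure set T -> \bar R})
    (f : T -> R) : (`|\int[m]_x f x|%R%:E <= \int[m]_x `|f x|%:E)%E.
Proof.
rewrite /Rintegral integralE.
have hp : (\int[m]_x (fun x => (f x)%:E)^\+ x <= \int[m]_x `|f x|%:E)%E.
  apply: ge0_le_integral_nomeas => // x _.
  by rewrite -[leRHS]/((abse \o (EFin \o f)) x) fune_abse leeDl.
have hn : (\int[m]_x (fun x => (f x)%:E)^\- x <= \int[m]_x `|f x|%:E)%E.
  apply: ge0_le_integral_nomeas => // x _.
  by rewrite -[leRHS]/((abse \o (EFin \o f)) x) fune_abse leeDr.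
have p0 : (0 <= \int[m]_x (fun x => (f x)%:E)^\+ x)%E by apply: integral_ge0.
have n0 : (0 <= \int[m]_x (fun x => (f x)%:E)^\- x)%E by apply: integral_ge0.
move: p0 n0 hp hn; case: (\int[m]_x `|f x|%:E)%E => [r| |].
- move: (integral _ _ _) (integral _ _ _) => [p| |] [n| |]//=.
  rewrite !lee_fin ler_norml => p0 n0 hp hn; apply/andP; split; lra.
- by move=> *; rewrite leey.
- by move=> p0 _ hp; have := le_trans p0 hp.
Qed.

Lemma measurable_Rintegral_param d (T : measurableType d) (h : T * rT -> R) :
  measurable_fun setT h -> measurable_fun setT (fun y => \int[mu]_s h (y, s)).
Proof.
move=> mh; apply: (measurableT_comp (f := @fine R)); first exact: fine_measurable.
have mEh : measurable_fun setT (EFin \o h) by exact/measurable_EFinP.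
rewrite (_ : (fun y => _) =
    (fubini_F mu (EFin \o h)^\+ \- fubini_F mu (EFin \o h)^\-)%E); last first.
  apply/funext => y; rewrite integralE /fubini_F /=.
  by congr (_ - _)%E; apply: eq_integral => s _; rewrite ?funeposE ?funenegE.
apply: (@emeasurable_funB _ T R setT).
  by apply: measurable_fun_fubini_tonelli_F => //; exact: measurable_funepos.
by apply: measurable_fun_fubini_tonelli_F => //; exact: measurable_funeneg.
Qed.

Lemma compact_support_parabola_bound (psi : R -> R) :
  continuous psi -> compact (closure [set x | psi x != 0]) ->
  exists M B : R, [/\ 0 <= M, 0 <= B &
    forall x, psi x != 0 -> - M <= x <= M /\ psi x <= B * (M ^+ 2 - x ^+ 2)].
Proof.
move=> cpsi /[dup] K /compact_bounded [M0 [_ HM]].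
have [B0 [_ HB]] : bounded_set (psi @` closure [set x | psi x != 0]).
  apply: compact_bounded; apply: continuous_compact K.
  exact: continuous_subspaceT.
pose M1 := `|M0| + 1; pose B1 := `|B0| + 1.
(* One unit beyond the radius [M1] of the support, so that the parabola is at least one on the
   support and a bound [B1] for [psi] can serve as the factor. *)
exists (M1 + 1), B1; split; [by rewrite !addr_ge0|by rewrite addr_ge0|].
move=> x px.
have cx : closure [set x | psi x != 0] x by exact: subset_closure.
have x1 : `|x| <= M1.
  by apply: HM => //; rewrite /M1 (le_lt_trans (ler_norm _))// ltrDl.
have p1 : `|psi x| <= B1.
  by apply: (HB B1); [rewrite /B1 (le_lt_trans (ler_norm _))// ltrDl|exists x].
move: x1 p1; rewrite !ler_norml => /andP[x1 x2] /andP[_ p2].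
have M10 : 0 <= M1 by rewrite addr_ge0.
have B10 : 0 <= B1 by rewrite addr_ge0.
split; first by apply/andP; split; lra.
apply: le_trans p2 _; rewrite ler_peMr//; nra.
Qed.

Lemma schwartz_real_bound (g : R * R * R -> R) : schwartz_real g ->
  exists2 B : R, 0 <= B & forall x t s,
    `|g (x, t, s)| <= B * (oneDsqr x)^-1 * (oneDsqr t)^-1 * (oneDsqr s)^-1.
Proof.
move=> [_ Hg].
have H i j k : exists M : R, forall x t s,
    `|x| ^+ i * `|t| ^+ j * `|s| ^+ k * `|g (x, t, s)| <= M.
  have [M HM] := Hg (i, j, k) (0, 0, 0)%N; exists M => x t s.
  by rewrite -!normrX -!normrM; exact: HM (x, t, s).
(* The eight monomials of the expansion of [(1 + x^2) (1 + t^2) (1 + s^2)]. *)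
have [M0 h0] := H 0%N 0%N 0%N; have [M1 h1] := H 2%N 0%N 0%N.
have [M2 h2] := H 0%N 2%N 0%N; have [M3 h3] := H 0%N 0%N 2%N.
have [M4 h4] := H 2%N 2%N 0%N; have [M5 h5] := H 2%N 0%N 2%N.
have [M6 h6] := H 0%N 2%N 2%N; have [M7 h7] := H 2%N 2%N 2%N.
have bnd x t s : `|g (x, t, s)| * (oneDsqr x * oneDsqr t * oneDsqr s) <=
    M0 + M1 + M2 + M3 + M4 + M5 + M6 + M7.
  have := h0 x t s; have := h1 x t s; have := h2 x t s; have := h3 x t s.
  have := h4 x t s; have := h5 x t s; have := h6 x t s; have := h7 x t s.
  rewrite !expr0 !mulr1 !mul1r !real_normK ?num_real// /oneDsqr; lra.
exists (M0 + M1 + M2 + M3 + M4 + M5 + M6 + M7).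
  by apply: le_trans (bnd 0 0 0); rewrite mulr_ge0// !mulr_ge0// (le_trans ler01).
move=> x t s; rewrite -!mulrA -!invfM mulrA.
have o1 (y : R) : 0 < oneDsqr y by exact: lt_le_trans ltr01 _.
by rewrite ler_pdivlMr ?mulr_gt0//; apply: le_trans (bnd x t s); rewrite mulrA.
Qed.

Lemma continuous_pairing (T U V : topologicalType) (f : T -> U) (g : T -> V) :
  continuous f -> continuous g -> continuous (fun y => (f y, g y)).
Proof.
move=> cf cg x; apply: (@continuous2_cvg _ _ _ _ _ _ f g pair); [|exact: cf|exact: cg].
by rewrite (_ : (fun z => (z.1, z.2)) = id); [exact: cvg_id|apply/funext => -[]].
Qed.

Lemma schwartz_real_measurable (g : R * R * R -> R) : schwartz_real g ->
  measurable_fun setT (g : rT * rT * rT -> R).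
Proof.
move=> [sg _].
have cg : continuous g by move=> p; apply: differentiable_continuous; exact: (sg [::]).
have cc (z : R) : continuous (fun _ : R => z) by move=> y; exact: cvg_cst.
have ci : continuous (fun y : R => y) by move=> y; exact: cvg_id.
have c1 t s := continuous_pairing (continuous_pairing ci (cc t)) (cc s).
have c2 x s := continuous_pairing (continuous_pairing (cc x) ci) (cc s).
have c3 x t := continuous_pairing (continuous_pairing (cc x) (cc t)) ci.
apply: measurable_fun_caratheodory => [s|[x t]].
  apply: (measurable_fun_caratheodory (f := fun p : rT * rT => g (p, s))) => [t|x].
    apply: continuous_measurable_fun => x.
    by apply: (continuous_comp (f := fun x : R => (x, t, s)) (g := g)); [exact: c1|exact: cg].
  move=> t.
  by apply: (continuous_comp (f := fun t : R => (x, t, s)) (g := g)); [exact: c2|exact: cg].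
move=> s.
by apply: (continuous_comp (f := fun s : R => (x, t, s)) (g := g)); [exact: c3|exact: cg].
Qed.
End preparation.

(** * From the Hermite-Fourier transform to the transform in [s] *)

Section transform_bound.
Context {R : realType}.
Local Notation mu := (@lebesgue_measure R).
Local Notation rT := (measurableTypeR R).

Lemma measurable_cosMM : measurable_fun setT (fun p : rT * rT => cos (p.1 * p.2)).
Proof.
apply: (measurableT_comp (f := @cos R)).
  by apply: continuous_measurable_fun; exact: continuous_cos.
by apply: (@measurable_funM _ _ R); [exact: measurable_fst|exact: measurable_snd].
Qed.

Lemma measurable_sinMM : measurable_fun setT (fun p : rT * rT => sin (p.1 * p.2)).
Proof.
apply: (measurableT_comp (f := @sin R)).
  by apply: continuous_measurable_fun; exact: continuous_sin.
by apply: (@measurable_funM _ _ R); [exact: measurable_fst|exact: measurable_snd].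
Qed.

Lemma measurable_cos_transform (g : rT * rT * rT -> R) : measurable_fun setT g ->
  measurable_fun setT (fun p : rT * rT * rT => cos_transform (fun s => g (p.1, s)) p.2).
Proof.
move=> mg.
apply: (measurable_Rintegral_param
  (h := fun z : (rT * rT * rT) * rT => g (z.1.1, z.2) * cos (z.1.2 * z.2))).
apply: (@measurable_funM _ _ R).
  apply: (measurableT_comp mg (g := fun z : (rT * rT * rT) * rT => (z.1.1, z.2))).
  measurable_proj.
apply: (measurableT_comp measurable_cosMM (g := fun z : (rT * rT * rT) * rT => (z.1.2, z.2))).
measurable_proj.
Qed.

Lemma measurable_sin_transform (g : rT * rT * rT -> R) : measurable_fun setT g ->
  measurable_fun setT (fun p : rT * rT * rT => sin_transform (fun s => g (p.1, s)) p.2).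
Proof.
move=> mg.
apply: (measurable_Rintegral_param
  (h := fun z : (rT * rT * rT) * rT => g (z.1.1, z.2) * sin (z.1.2 * z.2))).
apply: (@measurable_funM _ _ R).
  apply: (measurableT_comp mg (g := fun z : (rT * rT * rT) * rT => (z.1.1, z.2))).
  measurable_proj.
apply: (measurableT_comp measurable_sinMM (g := fun z : (rT * rT * rT) * rT => (z.1.2, z.2))).
measurable_proj.
Qed.

Lemma normr_Rintegral_lin4_le (h1 h2 h3 h4 : rT -> R) (a1 a2 a3 a4 m : R) :
  mu.-integrable setT (EFin \o h1) -> mu.-integrable setT (EFin \o h2) ->
  mu.-integrable setT (EFin \o h3) -> mu.-integrable setT (EFin \o h4) ->
  `|a1| <= m -> `|a2| <= m -> `|a3| <= m -> `|a4| <= m ->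
  `|\int[mu]_s (a1 * h1 s + a2 * h2 s + a3 * h3 s + a4 * h4 s)| <=
  m * (`|\int[mu]_s h1 s| + `|\int[mu]_s h2 s| + `|\int[mu]_s h3 s| + `|\int[mu]_s h4 s|).
Proof.
move=> i1 i2 i3 i4 m1 m2 m3 m4.
have Z a h : mu.-integrable setT (EFin \o h) ->
    mu.-integrable setT (EFin \o (fun s => a * h s)).
  by move=> ih; have := integrableZl measurableT a ih.
have D h k : mu.-integrable setT (EFin \o h) -> mu.-integrable setT (EFin \o k) ->
    mu.-integrable setT (EFin \o (fun s => h s + k s)).
  by move=> ih ik; have := integrableD measurableT ih ik.
have j1 := Z a1 _ i1; have j2 := Z a2 _ i2; have j3 := Z a3 _ i3; have j4 := Z a4 _ i4.
have j12 := D _ _ j1 j2; have j123 := D _ _ j12 j3.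
rewrite (RintegralD measurableT j123 j4) (RintegralD measurableT j12 j3).
rewrite (RintegralD measurableT j1 j2).
rewrite !RintegralZl// !mulrDr.
do 3 (apply: (le_trans (ler_normD _ _)); apply: lerD; last by rewrite normrM ler_wpM2r).
by rewrite normrM ler_wpM2r.
Qed.

Variables (f : R * R * R -> R[i]).
Let g1 : rT * rT * rT -> R := fun p => complex.Re (f p).
Let g2 : rT * rT * rT -> R := fun p => complex.Im (f p).

(** Replaces the modulus of the partial Fourier transform [F(x, t, nu)]. Unlike that modulus for
    complex [f], this sum is even in [nu], so both signs of [lambda] can be treated by one
    substitution. *)
Definition transform_sum (x t nu : R) : R :=
  `|cos_transform (fun s => g1 (x, t, s)) nu| + `|sin_transform (fun s => g1 (x, t, s)) nu| +
  `|cos_transform (fun s => g2 (x, t, s)) nu| + `|sin_transform (fun s => g2 (x, t, s)) nu|.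

Variable B : R.
Hypotheses (mg1 : measurable_fun setT g1) (mg2 : measurable_fun setT g2)
  (g1B : forall x t s, `|g1 (x, t, s)| <= B * (oneDsqr s)^-1)
  (g2B : forall x t s, `|g2 (x, t, s)| <= B * (oneDsqr s)^-1).

(** The phase in [t] has modulus one and is absorbed in the absolute values. Real and imaginary
    parts are each at most the same double integral, hence the factor [2]. *)
Lemma hermite_fourier_le (alpha : nat) (lambda nu : R) :
  ((cmod (hermite_fourier f (alpha, lambda, nu)) ^+ 2)%:E <=
   2%:E * (\int[mu]_x \int[mu]_t
      (`|scaled_hermite_fun alpha lambda x| * transform_sum x t nu)%:E *
    \int[mu]_x \int[mu]_t
      (`|scaled_hermite_fun alpha lambda x| * transform_sum x t nu)%:E))%E.
Proof.
pose Phi := scaled_hermite_fun alpha lambda.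
set I := (\int[mu]_x \int[mu]_t _)%E.
pose W x t : R[i] := cintegral (fun s => cexpi (lambda * t) * cexpi (nu * s) * f (x, t, s) *
    Complex (Phi x) 0).
have ic (g : R -> R) : measurable_fun setT g -> (forall s, `|g s| <= B * (oneDsqr s)^-1) ->
    mu.-integrable setT (EFin \o (fun s : rT => g s * cos (nu * s))).
  move=> mg gB; apply: (@integrable_le_oneDsqrV R B).
    by apply: measurable_funM => //; exact: measurable_cosM.
  by move=> s; rewrite normrM (le_trans _ (gB s))// ler_piMr// normr_cos_le1.
have isn (g : R -> R) : measurable_fun setT g -> (forall s, `|g s| <= B * (oneDsqr s)^-1) ->
    mu.-integrable setT (EFin \o (fun s : rT => g s * sin (nu * s))).
  move=> mg gB; apply: (@integrable_le_oneDsqrV R B).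
    by apply: measurable_funM => //; exact: measurable_sinM.
  by move=> s; rewrite normrM (le_trans _ (gB s))// ler_piMr// normr_sin_le1.
have ms1 x t : measurable_fun setT (fun s => g1 (x, t, s)).
  exact: (measurable_fun_pair2 (x, t) mg1).
have ms2 x t : measurable_fun setT (fun s => g2 (x, t, s)).
  exact: (measurable_fun_pair2 (x, t) mg2).
have Pc x t : `|Phi x * cos (lambda * t)| <= `|Phi x|.
  by rewrite normrM ler_piMr// normr_cos_le1.
have Ps x t : `|Phi x * sin (lambda * t)| <= `|Phi x|.
  by rewrite normrM ler_piMr// normr_sin_le1.
have ReW x t : `|complex.Re (W x t)| <= `|Phi x| * transform_sum x t nu.
  rewrite /W /cintegral /=.
  have -> : \int[mu]_s complex.Re (cexpi (lambda * t) * cexpi (nu * s) * f (x, t, s) *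
      Complex (Phi x) 0) =
    \int[mu]_s (Phi x * cos (lambda * t) * (g1 (x, t, s) * cos (nu * s)) +
      - (Phi x * sin (lambda * t)) * (g1 (x, t, s) * sin (nu * s)) +
      - (Phi x * sin (lambda * t)) * (g2 (x, t, s) * cos (nu * s)) +
      - (Phi x * cos (lambda * t)) * (g2 (x, t, s) * sin (nu * s))).
    apply: eq_Rintegral => s _; rewrite /g1 /g2; case: (f (x, t, s)) => a b /=; ring.
  apply: normr_Rintegral_lin4_le; rewrite ?normrN//.
  - exact: (ic _ (ms1 x t) (g1B x t)).
  - exact: (isn _ (ms1 x t) (g1B x t)).
  - exact: (ic _ (ms2 x t) (g2B x t)).
  - exact: (isn _ (ms2 x t) (g2B x t)).
have ImW x t : `|complex.Im (W x t)| <= `|Phi x| * transform_sum x t nu.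
  rewrite /W /cintegral /=.
  have -> : \int[mu]_s complex.Im (cexpi (lambda * t) * cexpi (nu * s) * f (x, t, s) *
      Complex (Phi x) 0) =
    \int[mu]_s (Phi x * sin (lambda * t) * (g1 (x, t, s) * cos (nu * s)) +
      Phi x * cos (lambda * t) * (g1 (x, t, s) * sin (nu * s)) +
      Phi x * cos (lambda * t) * (g2 (x, t, s) * cos (nu * s)) +
      - (Phi x * sin (lambda * t)) * (g2 (x, t, s) * sin (nu * s))).
    apply: eq_Rintegral => s _; rewrite /g1 /g2; case: (f (x, t, s)) => a b /=; ring.
  apply: normr_Rintegral_lin4_le; rewrite ?normrN//.
  - exact: (ic _ (ms1 x t) (g1B x t)).
  - exact: (isn _ (ms1 x t) (g1B x t)).
  - exact: (ic _ (ms2 x t) (g2B x t)).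
  - exact: (isn _ (ms2 x t) (g2B x t)).
have bnd (w : R -> R -> R) : (forall x t, `|w x t| <= `|Phi x| * transform_sum x t nu) ->
    (`|\int[mu]_x \int[mu]_t w x t|%:E <= I)%E.
  move=> hw; apply: le_trans (normr_Rintegral_le_nomeas _ _) _.
  apply: ge0_le_integral_nomeas => // x _.
  apply: le_trans (normr_Rintegral_le_nomeas _ _) _.
  by apply: ge0_le_integral_nomeas => // t _; rewrite lee_fin.
have I0 : (0 <= I)%E.
  apply: integral_ge0 => x _; apply: integral_ge0 => t _.
  by rewrite lee_fin mulr_ge0// !addr_ge0.
have sqI (re im : R) : (`|re|%:E <= I)%E -> (`|im|%:E <= I)%E ->
    ((re ^+ 2 + im ^+ 2)%:E <= 2%:E * (I * I))%E.
  move: I0; clearbody I; clear bnd; case: I => [r| |]//.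
    rewrite !lee_fin => r0 bR bI.
    have sq (z : R) : `|z| <= r -> z ^+ 2 <= r * r.
      by move=> zr; rewrite -real_normK ?num_real// expr2 ler_pM.
    have := sq _ bR; have := sq _ bI; lra.
  by move=> _ _ _; rewrite mulyy gt0_muley ?lte_fin// leey.
rewrite (_ : cmod _ ^+ 2 = (\int[mu]_x \int[mu]_t complex.Re (W x t)) ^+ 2 +
    (\int[mu]_x \int[mu]_t complex.Im (W x t)) ^+ 2); last first.
  by rewrite /cmod /= sqr_sqrtr ?addr_ge0 ?sqr_ge0.
by apply: sqI; [exact: bnd ReW|exact: bnd ImW].
Qed.
End transform_bound.

Lemma measurable_invr_ge0 d (T : measurableType d) (R : realType) (h : T -> R) :
  measurable_fun setT h -> (forall x, 0 <= h x) ->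
  measurable_fun setT (fun x => (h x)^-1).
Proof.
move=> mh h0; rewrite (_ : (fun x => _) = fun x => h x `^ (-1)); last first.
  by apply/funext => x; rewrite powR_inv1.
by apply: (measurableT_comp (f := fun x : R => x `^ (-1))); [exact: measurable_powR|].
Qed.

(** * Summation over the surface *)

Section restriction_estimate.
Context {R : realType}.
Local Notation mu := (@lebesgue_measure R).
Local Notation rT := (measurableTypeR R).
Local Open Scope ereal_scope.

Variables (f : R * R * R -> R[i]) (B : R).
Let g1 : rT * rT * rT -> R := fun p => complex.Re (f p).
Let g2 : rT * rT * rT -> R := fun p => complex.Im (f p).
Hypotheses (mg1 : measurable_fun setT g1) (mg2 : measurable_fun setT g2)
  (g1B : forall x t s, (`|g1 (x, t, s)| <= B * (oneDsqr s)^-1)%R)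
  (g2B : forall x t s, (`|g2 (x, t, s)| <= B * (oneDsqr s)^-1)%R).

Variables (psi : R -> R) (M Bpsi : R).
Hypotheses (psi0 : forall x, (0 <= psi x)%R) (mpsi : measurable_fun setT psi)
  (psi_even : forall x, psi (- x)%R = psi x) (M0 : (0 <= M)%R) (Bpsi0 : (0 <= Bpsi)%R)
  (psi_le : forall x, psi x != 0%R ->
     (- M <= x <= M)%R /\ (psi x <= Bpsi * (M ^+ 2 - x ^+ 2))%R).

(* [a t] dominates the x-norms of the slices of [f] at time [t], and [n t] is a
   positive majorant of the q-norm of [a t]. *)
Variables (q : R) (a : R -> R -> R) (n : R -> R) (N : R).
Hypotheses (q12 : (1 <= q <= 2)%R) (a0 : forall t s, (0 <= a t s)%R)
  (ma : forall t, measurable_fun setT (a t))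
  (g1a : forall t s, \int[mu]_x ((g1 (x, t, s) ^+ 2)%R)%:E <= (a t s ^+ 2)%:E)
  (g2a : forall t s, \int[mu]_x ((g2 (x, t, s) ^+ 2)%R)%:E <= (a t s ^+ 2)%:E)
  (n0 : forall t, (0 < n t)%R) (mn : measurable_fun setT n)
  (an : forall t, \int[mu]_s ((a t s `^ q)%R)%:E <= (n t `^ q)%:E)
  (N0 : (0 < N)%R) (nN : \int[mu]_t (n t)%:E <= N%:E).

Let Q := transform_sum f.

Let Q0 x t nu : (0 <= Q x t nu)%R.
Proof. by rewrite /Q /transform_sum !addr_ge0. Qed.

Lemma cos_transformN (g : R -> R) nu : cos_transform g (- nu)%R = cos_transform g nu.
Proof. by apply: eq_Rintegral => s _; rewrite mulNr cosN. Qed.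

Let sin_transformN (g : R -> R) nu : measurable_fun setT g ->
  (forall s, (`|g s| <= B * (oneDsqr s)^-1)%R) ->
  sin_transform g (- nu)%R = (- sin_transform g nu)%R.
Proof.
move=> mg gB; rewrite -[RHS]mulN1r /sin_transform -RintegralZl//.
  by apply: eq_Rintegral => s _; rewrite mulNr sinN mulrN mulN1r.
apply: (@integrable_le_oneDsqrV R B).
  by apply: measurable_funM => //; exact: measurable_sinM.
by move=> s; rewrite normrM (le_trans _ (gB s))// ler_piMr// normr_sin_le1.
Qed.

Let QN x t nu : Q x t (- nu)%R = Q x t nu.
Proof.
have ms1 := measurable_fun_pair2 (x, t) mg1.
have ms2 := measurable_fun_pair2 (x, t) mg2.
rewrite /Q /transform_sum !cos_transformN.
by rewrite (sin_transformN nu ms1 (g1B x t)) (sin_transformN nu ms2 (g2B x t)) !normrN.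
Qed.

Let mQ : measurable_fun setT (fun p : rT * rT * rT => Q p.1.1 p.1.2 p.2).
Proof.
have mc g : measurable_fun setT g -> measurable_fun setT
    (fun p : rT * rT * rT => `|cos_transform (fun s => g (p.1.1, p.1.2, s)) p.2|%R).
  move=> mg; apply: measurableT_comp => //.
  apply: (measurableT_comp (measurable_cos_transform mg)
    (g := fun p : rT * rT * rT => ((p.1.1, p.1.2), p.2))).
  measurable_proj.
have ms g : measurable_fun setT g -> measurable_fun setT
    (fun p : rT * rT * rT => `|sin_transform (fun s => g (p.1.1, p.1.2, s)) p.2|%R).
  move=> mg; apply: measurableT_comp => //.
  apply: (measurableT_comp (measurable_sin_transform mg)
    (g := fun p : rT * rT * rT => ((p.1.1, p.1.2), p.2))).
  measurable_proj.
apply: measurable_funD; last exact: (ms _ mg2).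
apply: measurable_funD; last exact: (mc _ mg2).
apply: measurable_funD; last exact: (ms _ mg1).
exact: (mc _ mg1).
Qed.

Let D : set R := `[(- M)%R, M]%classic.

Let e (g : rT * rT * rT -> R) (t x nu : R) : R :=
  ((M ^+ 2 - nu ^+ 2) * (cos_transform (fun s => g (x, t, s)) nu ^+ 2 +
                         sin_transform (fun s => g (x, t, s)) nu ^+ 2))%R.

Let e0 g t x nu : D nu -> (0 <= e g t x nu)%R.
Proof.
rewrite /D /= in_itv/= => h; apply: mulr_ge0; first exact: subr_sqr_ge0.
by rewrite addr_ge0 ?sqr_ge0.
Qed.

Let me_ g t : measurable_fun setT g ->
  measurable_fun setT (fun p : rT * rT => e g t p.1 p.2).
Proof.
move=> mg; apply: (@measurable_funM _ _ R).
  apply: (@measurable_funB _ _ R) => //; apply: (@measurable_funX _ _ R).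
  exact: measurable_snd.
apply: (@measurable_funD _ _ R); apply: (@measurable_funX _ _ R).
  apply: (measurableT_comp (measurable_cos_transform mg)
    (g := fun p : rT * rT => ((p.1, t), p.2))).
  measurable_proj.
apply: (measurableT_comp (measurable_sin_transform mg)
  (g := fun p : rT * rT => ((p.1, t), p.2))).
measurable_proj.
Qed.

Let C : R := (4 * M ^+ 3 + 8 * M + 8)%R.

Let psiQ_le t x nu : D nu ->
  (psi nu * (Q x t nu ^+ 2 / n t) <= 4 * Bpsi / n t * (e g1 t x nu + e g2 t x nu))%R.
Proof.
move=> Dnu; have nt := n0 t.
have -> : (psi nu * (Q x t nu ^+ 2 / n t) = (psi nu * Q x t nu ^+ 2) / n t)%R by rewrite mulrA.
have -> : (4 * Bpsi / n t * (e g1 t x nu + e g2 t x nu) =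
  (4 * Bpsi * (e g1 t x nu + e g2 t x nu)) / n t)%R by rewrite mulrAC.
rewrite ler_wpM2r ?invr_ge0 ?(ltW nt)//.
have [->|pn] := eqVneq (psi nu) 0%R.
  by rewrite mul0r !mulr_ge0// addr_ge0// e0.
have [_ ple] := psi_le pn.
have Q2 : (Q x t nu ^+ 2 <= 4 *
  ((cos_transform (fun s => g1 (x, t, s)) nu ^+ 2 + sin_transform (fun s => g1 (x, t, s)) nu ^+ 2) +
   (cos_transform (fun s => g2 (x, t, s)) nu ^+ 2 + sin_transform (fun s => g2 (x, t, s)) nu ^+ 2)))%R.
  rewrite /Q /transform_sum -/g1 -/g2.
  move: (cos_transform _ _) (sin_transform _ _) (cos_transform _ _) (sin_transform _ _) => u1 u2 u3 u4.
  rewrite -[(u1 ^+ 2)%R]real_normK ?num_real// -[(u2 ^+ 2)%R]real_normK ?num_real//.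
  rewrite -[(u3 ^+ 2)%R]real_normK ?num_real// -[(u4 ^+ 2)%R]real_normK ?num_real//.
  move: (`|u1|%R) (`|u2|%R) (`|u3|%R) (`|u4|%R) => v1 v2 v3 v4.
  have := sqr_ge0 (v1 - v2)%R; have := sqr_ge0 (v1 - v3)%R; have := sqr_ge0 (v1 - v4)%R.
  have := sqr_ge0 (v2 - v3)%R; have := sqr_ge0 (v2 - v4)%R; have := sqr_ge0 (v3 - v4)%R.
  nra.
apply: (@le_trans _ _ (Bpsi * (M ^+ 2 - nu ^+ 2) * Q x t nu ^+ 2)%R).
  by rewrite ler_wpM2r ?sqr_ge0.
have b0 : (0 <= Bpsi * (M ^+ 2 - nu ^+ 2))%R by exact: le_trans ple.
apply: le_trans (ler_wpM2l b0 Q2) _; rewrite /e le_eqVlt; apply/orP; left.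
apply/eqP; ring.
Qed.

Let psiQ0 t x nu : ~ D nu -> (psi nu * (Q x t nu ^+ 2 / n t) = 0)%R.
Proof.
move=> Dnu; have [->|/psi_le[h _]] := eqVneq (psi nu) 0%R; first by rewrite mul0r.
by exfalso; apply: Dnu; rewrite /D /= in_itv.
Qed.

(** The slice estimate is quadratic in [n t]; dividing by [n t] makes it linear, hence integrable in
    time. The [8] is the [4] of squaring a sum of four terms, doubled for real and imaginary
    parts. *)
Let fixed_time_le t :
  \int[mu]_x \int[mu]_nu ((psi nu * (Q x t nu ^+ 2 / n t))%R)%:E <=
  (8 * Bpsi * C * (1 + pi + pi) * n t)%:E.
Proof.
have nt := n0 t; pose k := (4 * Bpsi / n t)%R.
have k0 : (0 <= k)%R by rewrite divr_ge0 ?mulr_ge0// ltW.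
have mD : measurable D by exact: measurable_itv.
pose E g x := \int[mu]_(nu in D) (e g t x nu)%:E.
have E0 g x : 0 <= E g x.
  by apply: integral_ge0 => nu Dnu; rewrite lee_fin e0.
have mE g : measurable_fun setT g -> measurable_fun setT (E g).
  move=> mg.
  rewrite (_ : E g = fun x => \int[mu]_nu (e g t x nu * \1_D nu)%:E); last first.
    apply/funext => x; rewrite /E integral_mkcond; apply: eq_integral => nu _.
    by rewrite patchE indicE; case: ifPn; rewrite ?mulr1 ?mulr0.
  apply: (measurable_fun_fubini_tonelli_F (m2 := mu)
     (fun p : rT * rT => (e g t p.1 p.2 * \1_D p.2)%:E)).
    apply/measurable_EFinP; apply: (@measurable_funM _ _ R); first exact: me_.
    apply: (measurableT_comp (f := \1_D : R -> R)); first exact: measurable_indic.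
    exact: measurable_snd.
  move=> [x nu] /=; rewrite lee_fin indicE.
  by case: (boolP (nu \in D)) => [/set_mem/e0 h|_]; rewrite ?mulr1 ?mulr0.
have mes g x : measurable_fun setT g -> measurable_fun D (fun nu => (e g t x nu)%:E).
  move=> mg; apply: measurable_funTS; apply/measurable_EFinP.
  exact: (measurable_fun_pair2 x (me_ t mg)).
apply: (@le_trans _ _ (\int[mu]_x (k%:E * (E g1 x + E g2 x)))).
  apply: ge0_le_integral_nomeas => x _.
    by apply: integral_ge0 => nu _; rewrite lee_fin mulr_ge0// divr_ge0 ?sqr_ge0// ltW.
  have eD0 g nu : D nu -> 0 <= (e g t x nu)%:E by move=> h; rewrite lee_fin e0.
  have := @ge0_integralD _ rT R mu D mD (fun nu => (e g1 t x nu)%:E) (fun nu => (e g2 t x nu)%:E)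
    (eD0 g1) (mes _ x mg1) (eD0 g2) (mes _ x mg2).
  rewrite -/(E g1 x) -/(E g2 x) => <-.
  have mS : measurable_fun D (fun nu => (e g1 t x nu)%:E + (e g2 t x nu)%:E).
    by apply: emeasurable_funD; exact: mes.
  have S0 nu : D nu -> 0 <= (e g1 t x nu)%:E + (e g2 t x nu)%:E.
    by move=> h; rewrite adde_ge0 ?eD0.
  have k0E : 0 <= k%:E by rewrite lee_fin.
  rewrite -(@ge0_integralZl _ rT R mu D mD _ mS k%:E S0 k0E).
  rewrite [leRHS]integral_mkcond; apply: ge0_le_integral_nomeas => nu _.
    by rewrite lee_fin mulr_ge0// divr_ge0 ?sqr_ge0// ltW.
  rewrite patchE; case: ifPn => nuD; last first.
    by rewrite psiQ0// => /mem_set; apply/negP.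
  by rewrite -EFinD -EFinM lee_fin psiQ_le//; exact: set_mem.
rewrite ge0_integralZl_real//; last 2 first.
- by apply: emeasurable_funD; exact: mE.
- by move=> x; rewrite adde_ge0.
rewrite ge0_integralDT//; try exact: mE.
have En (g : rT * rT * rT -> R) : measurable_fun setT g -> (forall x t s, (`|g (x, t, s)| <= B * (oneDsqr s)^-1)%R) ->
    (forall t s, \int[mu]_x ((g (x, t, s) ^+ 2)%R)%:E <= (a t s ^+ 2)%:E) ->
    \int[mu]_x E g x <= (C * (n t ^+ 2 * (1 + pi + pi)))%:E.
  move=> mg gB ga.
  apply: (@slice_energy_le R q M B (fun p => g ((p.1, t), p.2)) (a t) (n t)) => //.
    apply: (measurableT_comp mg (g := fun p : rT * rT => ((p.1, t), p.2))).
    measurable_proj.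
  exact: ga.
apply: (@le_trans _ _ (k%:E * ((C * (n t ^+ 2 * (1 + pi + pi)))%:E +
                               (C * (n t ^+ 2 * (1 + pi + pi)))%:E))).
  apply: lee_wpmul2l; first by rewrite lee_fin.
  by apply: leeD; [exact: (En _ mg1)|exact: (En _ mg2)].
rewrite -EFinD -EFinM lee_fin le_eqVlt; apply/orP; left; apply/eqP.
by rewrite /k; field; rewrite gt_eqF.
Qed.

Let nV t : (0 <= (n t)^-1)%R. Proof. by rewrite invr_ge0 ltW. Qed.

Let mnV : measurable_fun setT (fun t => (n t)^-1%R).
Proof.
by apply: (measurable_invr_ge0 mn) => t; rewrite ltW.
Qed.

Let QnE t x nu : 0 <= ((Q x t nu ^+ 2 / n t)%R)%:E.
Proof. by rewrite lee_fin mulr_ge0 ?sqr_ge0. Qed.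

Let mQn : measurable_fun setT
  (fun p : rT * rT * rT => ((Q p.1.1 p.1.2 p.2 ^+ 2 / n p.1.2)%R)%:E).
Proof.
apply/measurable_EFinP; apply: (@measurable_funM _ _ R).
  exact: (@measurable_funX _ _ R).
apply: (measurableT_comp mnV (g := fun p : rT * rT * rT => p.1.2)).
measurable_proj.
Qed.

Let energy_total_le :
  \int[mu]_nu \int[mu]_x \int[mu]_t ((psi nu * (Q x t nu ^+ 2 / n t))%R)%:E <=
  (8 * Bpsi * C * (1 + pi + pi) * N)%:E.
Proof.
pose P (x t nu : rT) := ((psi nu * (Q x t nu ^+ 2 / n t))%R)%:E.
have P0 x t nu : 0 <= P x t nu by rewrite lee_fin mulr_ge0// mulr_ge0 ?sqr_ge0.
have mP : measurable_fun setT (fun p : rT * rT * rT => P p.1.1 p.1.2 p.2).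
  apply/measurable_EFinP; apply: (@measurable_funM _ _ R).
    exact: (measurableT_comp mpsi measurable_snd).
  by apply/measurable_EFinP.
rewrite (fubini_tonelli (fun p : rT * rT => \int[mu]_t P p.2 t p.1)); last 2 first.
- apply: (measurable_fun_fubini_tonelli_F (m2 := mu)
    (fun z : (rT * rT) * rT => P z.1.2 z.2 z.1.1)) => //.
  apply: (measurableT_comp mP (g := fun z : (rT * rT) * rT => ((z.1.2, z.2), z.1.1))).
  measurable_proj.
- by move=> p; apply: integral_ge0.
rewrite (eq_integral (fun x : rT => \int[mu]_t \int[mu]_nu P x t nu)); last first.
  move=> x _; rewrite (fubini_tonelli (fun p : rT * rT => P x p.2 p.1)) //.
  apply: (measurableT_comp mP (g := fun z : rT * rT => ((x, z.2), z.1))).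
  measurable_proj.
rewrite (fubini_tonelli (fun p : rT * rT => \int[mu]_nu P p.1 p.2 nu)); last 2 first.
- apply: (measurable_fun_fubini_tonelli_F (m2 := mu)
    (fun z : (rT * rT) * rT => P z.1.1 z.1.2 z.2)) => //.
- by move=> p; apply: integral_ge0.
have K0 : (0 <= 8 * Bpsi * C * (1 + pi + pi))%R.
  have C0 : (0 <= C)%R by rewrite /C !addr_ge0// mulr_ge0// exprn_ge0.
  have p0 : (0 <= 1 + pi + pi :> R)%R by have := pi_ge0 R; lra.
  by rewrite mulr_ge0// mulr_ge0// mulr_ge0.
apply: (@le_trans _ _ (\int[mu]_t ((8 * Bpsi * C * (1 + pi + pi))%:E * (n t)%:E))).
  apply: ge0_le_integral_nomeas => t _; last by rewrite -EFinM; exact: fixed_time_le.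
  by apply: integral_ge0 => x _; apply: integral_ge0.
rewrite ge0_integralZl_real//; last 2 first.
- exact/measurable_EFinP.
- by move=> t; rewrite lee_fin ltW.
by rewrite [leRHS]EFinM; apply: lee_wpmul2l; rewrite ?lee_fin.
Qed.

Let U (alpha : nat) : R := Num.sqrt (2 * alpha + 1)%:R.

Let U0 alpha : (0 < U alpha)%R.
Proof. by rewrite sqrtr_gt0 ltr0n addn1. Qed.

(** The absolute value extends the weight evenly to negative [nu], in accord with the parity of
    [psi] and [Q]. *)
Let W alpha (nu x : R) : R := inv_weight (U alpha) (quartic_weight `|nu|%R x).

Let W0 alpha nu x : (0 < W alpha nu x)%R.
Proof.
have := quartic_weight_gt0 (normr_ge0 nu) x.
rewrite /W /inv_weight => t0.
by rewrite addr_gt0 ?addr_gt0// divr_gt0.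
Qed.

Let mW alpha : measurable_fun setT (fun p : rT * rT => W alpha p.1 p.2).
Proof.
have mqw : measurable_fun setT (fun p : rT * rT => quartic_weight `|p.1|%R p.2).
  rewrite /quartic_weight.
  have ms : measurable_fun setT (@Num.sqrt R).
    by apply: continuous_measurable_fun; exact: sqrt_continuous.
  do 2 apply: (measurableT_comp ms).
  apply: (@measurable_funD _ _ R) => //; apply: (@measurable_funM _ _ R).
    by apply: (measurableT_comp (f := fun x : R => `|x|%R)) measurable_fst.
  by apply: (@measurable_funX _ _ R); exact: measurable_snd.
rewrite /W /inv_weight; apply: (@measurable_funD _ _ R).
  apply: (@measurable_funD _ _ R) => //; apply: (@measurable_funM _ _ R) => //.
  by apply: (measurable_invr_ge0 mqw) => p; rewrite sqrtr_ge0.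
exact: (@measurable_funM _ _ R).
Qed.

Let mWV alpha : measurable_fun setT (fun p : rT * rT => ((W alpha p.1 p.2)^-1)%R).
Proof. by apply: (measurable_invr_ge0 (mW alpha)) => p; exact: ltW. Qed.

Let Z (x nu : R) := \int[mu]_t ((Q x t nu ^+ 2 / n t)%R)%:E.

Let Z0 x nu : 0 <= Z x nu. Proof. by apply: integral_ge0. Qed.

Let mZ : measurable_fun setT (fun p : rT * rT => Z p.2 p.1).
Proof.
apply: (measurable_fun_fubini_tonelli_F (m2 := mu)
  (fun z : (rT * rT) * rT => ((Q z.1.2 z.2 z.1.1 ^+ 2 / n z.2)%R)%:E)) => //.
apply: (measurableT_comp mQn (g := fun z : (rT * rT) * rT => ((z.1.2, z.2), z.1.1))).
measurable_proj.
Qed.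

(** Cauchy-Schwarz twice: in [t] with weight [n], whose mass is at most [N], and in [x] with weight
    [W], which costs [39]. With the factor [2] of [hermite_fourier_le] this makes [78 * N]. *)
Let hermite_fourier_sq_le alpha lambda nu : lambda != 0%R ->
  nu = ((2 * alpha + 1)%:R * `|lambda|)%R ->
  (cmod (hermite_fourier f (alpha, lambda, nu)) ^+ 2)%:E <=
  (78 * N)%:E * \int[mu]_x (((W alpha nu x)^-1)%:E * Z x nu).
Proof.
move=> l0 nuA.
have nuE : `|nu|%R = nu by rewrite nuA ger0_norm// mulr_ge0.
apply: le_trans (hermite_fourier_le mg1 mg2 g1B g2B _ _ _) _.
pose Phi := scaled_hermite_fun alpha lambda.
have mQx x : measurable_fun setT (fun t : rT => (Q x t nu)%:E).
  apply/measurable_EFinP.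
  apply: (measurableT_comp mQ (g := fun t : rT => ((x, t), nu))).
  measurable_proj.
have mQnx x : measurable_fun setT (fun t : rT => ((Q x t nu ^+ 2 / n t)%R)%:E).
  apply: (measurableT_comp mQn (g := fun t : rT => ((x, t), nu))).
  measurable_proj.
have mZx : measurable_fun setT (fun x : rT => Z x nu).
  exact: (measurable_fun_pair2 nu mZ).
have mWx : measurable_fun setT (fun x : rT => ((W alpha nu x)^-1)%:E).
  by apply/measurable_EFinP; exact: (measurable_fun_pair2 nu (mWV alpha)).
have JJ x : (\int[mu]_t (Q x t nu)%:E) * (\int[mu]_t (Q x t nu)%:E) <= N%:E * Z x nu.
  apply: (@integral_cauchy_schwarz_ereal _ _ _ mu (fun t : rT => (n t)%:E)) => //.
  - exact/measurable_EFinP.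
  - by move=> t; rewrite lee_fin ltW.
  - by move=> t; rewrite lee_fin Q0.
  - move=> t; rewrite -!EFinM lee_fin mulrCA divff ?gt_eqF// mulr1.
    by rewrite expr2.
pose c x := \int[mu]_t (`|Phi x| * Q x t nu)%:E.
have cE x : c x = (`|Phi x|)%:E * \int[mu]_t (Q x t nu)%:E.
  rewrite /c; under eq_integral do rewrite EFinM.
  by rewrite ge0_integralZl_real// => t; rewrite lee_fin.
have CS : (\int[mu]_x c x) * (\int[mu]_x c x) <=
    39%:E * \int[mu]_x (N%:E * (((W alpha nu x)^-1)%:E * Z x nu)).
  apply: (@integral_cauchy_schwarz_ereal _ _ _ mu (fun x : rT => (Phi x ^+ 2 * W alpha nu x)%:E)) => //.
  - apply/measurable_EFinP; apply: (@measurable_funM _ _ R).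
      apply: measurable_funX; exact: measurable_scaled_hermite_fun.
    exact: (measurable_fun_pair2 nu (mW alpha)).
  - by apply: emeasurable_funM => //; exact: emeasurable_funM.
  - by move=> x; rewrite lee_fin mulr_ge0 ?sqr_ge0// ltW.
  - by move=> x; rewrite mule_ge0 ?lee_fin ?(ltW N0)// mule_ge0// lee_fin invr_ge0 ltW.
  - by move=> x; apply: integral_ge0 => t _; rewrite lee_fin mulr_ge0.
  - move=> x; rewrite cE muleACA -EFinM.
    apply: (@le_trans _ _ ((`|Phi x| * `|Phi x|)%:E * (N%:E * Z x nu))).
      by apply: lee_wpmul2l => //; rewrite lee_fin mulr_ge0.
    rewrite -expr2 real_normK ?num_real// muleCA [leRHS]muleCA; apply: lee_wpmul2l.
      by rewrite lee_fin ltW.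
    rewrite [leRHS]muleA -EFinM (_ : (_ * _ / _)%R = (Phi x ^+ 2)%R)//.
    by rewrite -mulrA divff ?mulr1// gt_eqF.
  - rewrite (eq_integral (fun x : rT => (scaled_hermite_fun alpha lambda x ^+ 2 *
     inv_weight (U alpha) (quartic_weight ((2 * alpha + 1)%:R * `|lambda|) x))%:E)).
      exact: scaled_hermite_fun_inv_weight.
    by move=> x _; rewrite /W nuE nuA.
have bigE : 2%:E * (39%:E * \int[mu]_x (N%:E * (((W alpha nu x)^-1)%:E * Z x nu))) =
    (78 * N)%:E * \int[mu]_x (((W alpha nu x)^-1)%:E * Z x nu).
  rewrite ge0_integralZl_real ?(ltW N0)//; last 2 first.
  - exact: emeasurable_funM.
  - by move=> x; rewrite mule_ge0// lee_fin invr_ge0 ltW.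
  by rewrite !muleA -!EFinM; congr (_%:E * _); ring.
rewrite -bigE; apply: lee_wpmul2l; first by rewrite lee_fin.
exact: CS.
Qed.

Let Y alpha (nu : R) := \int[mu]_x (((W alpha nu x)^-1)%:E * ((psi nu)%:E * Z x nu)).

Let Y_ge0 alpha nu x : 0 <= ((W alpha nu x)^-1)%:E * ((psi nu)%:E * Z x nu).
Proof. by rewrite mule_ge0 ?lee_fin ?invr_ge0 ?(ltW (W0 _ _ _))// mule_ge0 ?lee_fin. Qed.

Let mY2 alpha : measurable_fun setT
  (fun p : rT * rT => ((W alpha p.1 p.2)^-1)%:E * ((psi p.1)%:E * Z p.2 p.1)).
Proof.
apply: emeasurable_funM; first exact/measurable_EFinP.
apply: emeasurable_funM => //; apply/measurable_EFinP.
exact: (measurableT_comp mpsi measurable_fst).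
Qed.

Let mY alpha : measurable_fun setT (Y alpha).
Proof.
apply: (measurable_fun_fubini_tonelli_F (m2 := mu) _ (mY2 alpha)).
by move=> p; exact: Y_ge0.
Qed.

Let Y0 alpha nu : 0 <= Y alpha nu.
Proof. by apply: integral_ge0 => x _; exact: Y_ge0. Qed.

Let YN alpha nu : Y alpha (- nu)%R = Y alpha nu.
Proof.
apply: eq_integral => x _; rewrite /W normrN psi_even /Z.
by under eq_integral do rewrite QN.
Qed.

Let restriction_sq_le alpha lambda : lambda != 0%R ->
  (cmod (restriction_op f (alpha, lambda, ((2 * alpha + 1)%:R * `|lambda|)%R)) ^+ 2)%:E *
    (psi ((2 * alpha + 1)%:R * `|lambda|)%R)%:E <=
  (78 * N)%:E * Y alpha ((2 * alpha + 1)%:R * lambda + 0)%R.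
Proof.
move=> l0; set nu := ((2 * alpha + 1)%:R * `|lambda|)%R.
have -> : restriction_op f (alpha, lambda, nu) = hermite_fourier f (alpha, lambda, nu).
  by rewrite /restriction_op /patch mem_set.
(* Evenness of [Y] exchanges [|lambda|] for [lambda], so that the substitution is affine on the
   whole line; the [+ 0] is the shape expected by [ge0_integral_affine]. *)
have -> : Y alpha ((2 * alpha + 1)%:R * lambda + 0)%R = Y alpha nu.
  rewrite addr0 /nu; have [l1|l1] := leP 0%R lambda.
    by rewrite (ger0_norm l1).
  by rewrite (ltr0_norm l1) mulrN; exact: esym (YN alpha _).
have -> : Y alpha nu = (psi nu)%:E * \int[mu]_x (((W alpha nu x)^-1)%:E * Z x nu).
  rewrite -ge0_integralZl_real//; last 2 first.
  - apply: emeasurable_funM.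
      by apply/measurable_EFinP; exact: (measurable_fun_pair2 nu (mWV alpha)).
    exact: (measurable_fun_pair2 nu mZ).
  - by move=> x; rewrite mule_ge0// lee_fin invr_ge0 ltW.
  by apply: eq_integral => x _; rewrite muleCA.
rewrite muleC muleCA; apply: lee_wpmul2l; first by rewrite lee_fin.
exact: hermite_fourier_sq_le.
Qed.

Let odd_gt0 alpha : (0 < (2 * alpha + 1)%:R :> R)%R.
Proof. by rewrite ltr0n addn1. Qed.

Let term_le alpha :
  \int[mu]_(lambda in [set l : R | l != 0%R])
    ((cmod (restriction_op f (alpha, lambda, ((2 * alpha + 1)%:R * `|lambda|)%R)) ^+ 2)%:E *
     (psi ((2 * alpha + 1)%:R * `|lambda|)%R)%:E) <=
  (78 * N)%:E * ((2 * alpha + 1)%:R^-1%:E * \int[mu]_nu Y alpha nu).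
Proof.
rewrite -(ge0_integral_affine 0 (odd_gt0 alpha) (mY alpha) (Y0 alpha)).
rewrite -ge0_integralZl_real//; last 2 first.
- by rewrite mulr_ge0// ltW.
- by apply: (measurableT_comp (mY alpha)); apply: (@measurable_funD _ _ R).
rewrite [leLHS]integral_mkcond; apply: ge0_le_integral_nomeas => l _.
  by rewrite patchE; case: ifPn => // _; rewrite mule_ge0 ?lee_fin ?sqr_ge0.
rewrite patchE; case: ifPn => [|_].
  by rewrite inE /= => l0; exact: restriction_sq_le.
by rewrite mule_ge0// lee_fin mulr_ge0// ltW.
Qed.

(** The sum has to be taken under the integrals, because the bound on the weights holds at fixed
    [(nu, x)], through [t = quartic_weight |nu| x]. *)
Let sum_Y_le K :
  \sum_(0 <= alpha < K) ((2 * alpha + 1)%:R^-1%:E * \int[mu]_nu Y alpha nu) <=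
  (8 * Bpsi * C * (1 + pi + pi) * N)%:E.
Proof.
have cV alpha : (0 <= (2 * alpha + 1)%:R^-1 :> R)%R by rewrite invr_ge0.
apply: le_trans energy_total_le.
have -> : \sum_(0 <= alpha < K) ((2 * alpha + 1)%:R^-1%:E * \int[mu]_nu Y alpha nu) =
    \int[mu]_nu \int[mu]_x \sum_(0 <= alpha < K) ((2 * alpha + 1)%:R^-1%:E *
      (((W alpha nu x)^-1)%:E * ((psi nu)%:E * Z x nu))).
  have mf alpha : measurable_fun setT (fun nu : rT => (2 * alpha + 1)%:R^-1%:E * Y alpha nu).
    by apply: measurable_funeM; exact: mY.
  have f0 alpha (nu : rT) : setT nu -> 0 <= (2 * alpha + 1)%:R^-1%:E * Y alpha nu.
    by move=> _; rewrite mule_ge0// lee_fin.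
  rewrite (eq_bigr (fun alpha => \int[mu]_nu ((2 * alpha + 1)%:R^-1%:E * Y alpha nu))); last first.
    by move=> alpha _; rewrite (ge0_integralZl_real mu (cV alpha) (mY alpha) (Y0 alpha)).
  rewrite -(ge0_integral_sum mu measurableT mf f0).
  apply: eq_integral => nu _.
  have mYx alpha : measurable_fun setT
      (fun x : rT => ((W alpha nu x)^-1)%:E * ((psi nu)%:E * Z x nu)).
    exact: (measurable_fun_pair2 nu (mY2 alpha)).
  have mg alpha : measurable_fun setT (fun x : rT => (2 * alpha + 1)%:R^-1%:E *
      (((W alpha nu x)^-1)%:E * ((psi nu)%:E * Z x nu))).
    by apply: measurable_funeM; exact: mYx.
  have g0 alpha (x : rT) : setT x -> 0 <= (2 * alpha + 1)%:R^-1%:E *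
      (((W alpha nu x)^-1)%:E * ((psi nu)%:E * Z x nu)).
    by move=> _; rewrite mule_ge0// lee_fin.
  rewrite (ge0_integral_sum mu measurableT mg g0).
  apply: eq_bigr => alpha _.
  by rewrite (ge0_integralZl_real mu (cV alpha) (mYx alpha) (Y_ge0 alpha nu)).
apply: ge0_le_integral_nomeas => nu _.
  by apply: integral_ge0 => x _; apply: sume_ge0 => alpha _; rewrite mule_ge0// lee_fin.
apply: ge0_le_integral_nomeas => x _.
  by apply: sume_ge0 => alpha _; rewrite mule_ge0// lee_fin.
rewrite (eq_bigr (fun alpha => (((2 * alpha + 1)%:R^-1 * (W alpha nu x)^-1)%R)%:E *
    ((psi nu)%:E * Z x nu))); last by move=> alpha _; rewrite EFinM muleA.
rewrite -ge0_sume_distrl; last first.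
  by move=> alpha _; rewrite lee_fin mulr_ge0// invr_ge0 ltW.
rewrite sumEFin.
have t0 := quartic_weight_gt0 (normr_ge0 nu) x.
apply: (@le_trans _ _ (1%:E * ((psi nu)%:E * Z x nu))).
  apply: lee_wpmul2r; first by rewrite mule_ge0// lee_fin.
  by rewrite lee_fin; exact: sum_inv_weight_le.
rewrite mul1e -ge0_integralZl_real//; last first.
  apply: (measurableT_comp mQn (g := fun t : rT => ((x, t), nu))).
  measurable_proj.
Qed.

Lemma sigma_loc_integral_le :
  sigma_loc_integral psi (fun p => ((cmod (restriction_op f p)) ^+ 2)%:E) <=
  ((78 * (8 * Bpsi * (4 * M ^+ 3 + 8 * M + 8) * (1 + pi + pi))) * N ^+ 2)%:E.
Proof.
rewrite /sigma_loc_integral; apply: lime_le.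
  apply: is_cvg_nneseries => alpha _ _; apply: integral_ge0 => l _.
  by rewrite mule_ge0 ?lee_fin ?sqr_ge0.
apply: nearW => K.
apply: (@le_trans _ _ (\sum_(0 <= alpha < K) ((78 * N)%:E *
    ((2 * alpha + 1)%:R^-1%:E * \int[mu]_nu Y alpha nu)))).
  by apply: lee_sum => alpha _; exact: term_le.
rewrite -ge0_sume_distrr; last first.
  move=> alpha _; rewrite mule_ge0 ?lee_fin ?invr_ge0//.
  by apply: integral_ge0 => nu _; exact: Y0.
apply: (@le_trans _ _ ((78 * N)%:E * (8 * Bpsi * C * (1 + pi + pi) * N)%:E)).
  by apply: lee_wpmul2l (sum_Y_le K); rewrite lee_fin mulr_ge0// ltW.
rewrite -EFinM lee_fin le_eqVlt; apply/orP; left; apply/eqP.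
by rewrite /C; ring.
Qed.
End restriction_estimate.

(** * The mixed norm through real-valued slice norms *)

Section mixed_norm_majorant.
Context {R : realType}.
Local Notation mu := (@lebesgue_measure R).
Local Notation rT := (measurableTypeR R).
Local Open Scope ereal_scope.

Variables (f : R * R * R -> R[i]) (B q : R).
Let g1 : rT * rT * rT -> R := fun p => complex.Re (f p).
Let g2 : rT * rT * rT -> R := fun p => complex.Im (f p).
Let k (x : R) : R := ((oneDsqr x)^-1)%R.
Hypotheses (B0 : (0 <= B)%R) (q12 : (1 <= q <= 2)%R)
  (mg1 : measurable_fun setT g1) (mg2 : measurable_fun setT g2)
  (g1B : forall x t s, (`|g1 (x, t, s)| <= B * k x * k t * k s)%R)
  (g2B : forall x t s, (`|g2 (x, t, s)| <= B * k x * k t * k s)%R).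

Let k0 x : (0 <= k x)%R. Proof. by rewrite invr_ge0. Qed.
Let k1 x : (k x <= 1)%R. Proof. exact: oneDsqrV_le1. Qed.

Let mk : measurable_fun setT k.
Proof. by apply: continuous_measurable_fun; exact: continuous_oneDsqrV. Qed.

Let ik : \int[mu]_x (k x)%:E = pi%:E. Proof. exact: integral_oneDsqrV. Qed.

Let cmod2 (p : R * R * R) : (cmod (f p) ^+ 2 = g1 p ^+ 2 + g2 p ^+ 2)%R.
Proof.
by rewrite /cmod /g1 /g2; case: (f p) => u v /=; rewrite sqr_sqrtr ?addr_ge0 ?sqr_ge0.
Qed.

Definition slice_norm2 (t s : R) : \bar R := \int[mu]_x ((cmod (f (x, t, s)) ^+ 2)%R)%:E.

Definition slice_norm (t s : R) : R := Num.sqrt (fine (slice_norm2 t s)).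

Let mcmod2 : measurable_fun setT
  (fun p : rT * rT * rT => ((cmod (f (p.2, p.1.1, p.1.2)) ^+ 2)%R)%:E).
Proof.
apply/measurable_EFinP.
rewrite (_ : (fun p => _) = (fun p : rT * rT * rT =>
   (g1 (p.2, p.1.1, p.1.2) ^+ 2 + g2 (p.2, p.1.1, p.1.2) ^+ 2)%R)); last first.
  by apply/funext => p; rewrite cmod2.
by apply: (@measurable_funD _ _ R); apply: (@measurable_funX _ _ R);
  [apply: (measurableT_comp mg1 (g := fun p : rT * rT * rT => ((p.2, p.1.1), p.1.2)))
  |apply: (measurableT_comp mg2 (g := fun p : rT * rT * rT => ((p.2, p.1.1), p.1.2)))];
  measurable_proj.
Qed.

Let mslice2 : measurable_fun setT (fun p : rT * rT => slice_norm2 p.1 p.2).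
Proof.
apply: (measurable_fun_fubini_tonelli_F (m2 := mu)
  (fun p : rT * rT * rT => ((cmod (f (p.2, p.1.1, p.1.2)) ^+ 2)%R)%:E) mcmod2).
by move=> p; rewrite lee_fin sqr_ge0.
Qed.

Let slice2_ge0 t s : 0 <= slice_norm2 t s.
Proof. by apply: integral_ge0 => x _; rewrite lee_fin sqr_ge0. Qed.

Let slice2_le t s : slice_norm2 t s <= ((2 * B ^+ 2 * pi) * (k t * k s) ^+ 2)%:E.
Proof.
apply: (@le_trans _ _ (\int[mu]_x (((2 * B ^+ 2) * (k t * k s) ^+ 2)%:E * (k x)%:E))).
  apply: ge0_le_integral_nomeas => x _; first by rewrite lee_fin sqr_ge0.
  rewrite -EFinM lee_fin cmod2.
  have sq (z : R) : (`|z| <= B * k x * k t * k s -> z ^+ 2 <= B ^+ 2 * (k t * k s) ^+ 2 * k x)%R.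
    move=> zb; rewrite -real_normK ?num_real//.
    apply: (@le_trans _ _ ((B * k x * k t * k s) ^+ 2)%R).
      by rewrite ler_pXn2r ?nnegrE// !mulr_ge0.
    have -> : ((B * k x * k t * k s) ^+ 2 = B ^+ 2 * (k t * k s) ^+ 2 * (k x * k x))%R by ring.
    by rewrite ler_wpM2l ?mulr_ge0 ?sqr_ge0// ler_piMr.
  have := sq _ (g1B x t s); have := sq _ (g2B x t s); lra.
rewrite ge0_integralZl_real//; last 2 first.
- by rewrite mulr_ge0 ?sqr_ge0// mulr_ge0 ?sqr_ge0.
- exact/measurable_EFinP.
by rewrite ik -EFinM lee_fin mulrAC.
Qed.

Lemma slice_norm2E t s : slice_norm2 t s = (slice_norm t s ^+ 2)%:E.
Proof.
rewrite /slice_norm sqr_sqrtr ?fine_ge0// fineK// ge0_fin_numE//.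
exact: le_lt_trans (slice2_le t s) (ltry _).
Qed.

Let L : R := Num.sqrt (2 * B ^+ 2 * pi).

Let slice_le t s : (slice_norm t s <= L * (k t * k s))%R.
Proof.
have p0 : (0 <= 2 * B ^+ 2 * pi :> R)%R by rewrite !mulr_ge0 ?sqr_ge0 ?pi_ge0.
rewrite -(@ler_pXn2r _ 2)// ?nnegrE ?sqrtr_ge0//; last by rewrite !mulr_ge0 ?sqrtr_ge0.
rewrite exprMn [X in (_ <= X * _)%R]sqr_sqrtr//.
by have := slice2_le t s; rewrite slice_norm2E lee_fin.
Qed.

Lemma measurable_slice_norm : measurable_fun setT (fun p : rT * rT => slice_norm p.1 p.2).
Proof.
apply: (measurableT_comp (f := @Num.sqrt R)).
  by apply: continuous_measurable_fun; exact: sqrt_continuous.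
by apply: (measurableT_comp (f := @fine R)) mslice2; exact: fine_measurable.
Qed.

Let sq_int_le t s (g : rT * rT * rT -> R) :
  (forall p, (g p ^+ 2 <= cmod (f p) ^+ 2)%R) ->
  \int[mu]_x ((g (x, t, s) ^+ 2)%R)%:E <= (slice_norm t s ^+ 2)%:E.
Proof.
move=> h; rewrite -slice_norm2E; apply: ge0_le_integral_nomeas => x _.
  by rewrite lee_fin sqr_ge0.
by rewrite lee_fin.
Qed.

Lemma slice_norm_Re t s : \int[mu]_x ((g1 (x, t, s) ^+ 2)%R)%:E <= (slice_norm t s ^+ 2)%:E.
Proof. by apply: sq_int_le => p; rewrite cmod2 lerDl sqr_ge0. Qed.

Lemma slice_norm_Im t s : \int[mu]_x ((g2 (x, t, s) ^+ 2)%R)%:E <= (slice_norm t s ^+ 2)%:E.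
Proof. by apply: sq_int_le => p; rewrite cmod2 lerDr sqr_ge0. Qed.

Definition time_norm_pow (t : R) : \bar R := \int[mu]_s ((slice_norm t s `^ q)%R)%:E.

Definition time_norm (t : R) : R := ((fine (time_norm_pow t)) `^ (q^-1))%R.

Let q0 : (0 < q)%R. Proof. by case/andP: q12 => h _; lra. Qed.

Let powq_ge0 t s : 0 <= ((slice_norm t s `^ q)%R)%:E.
Proof. by rewrite lee_fin powR_ge0. Qed.

Let mpowq : measurable_fun setT (fun p : rT * rT => ((slice_norm p.1 p.2 `^ q)%R)%:E).
Proof.
apply/measurable_EFinP.
apply: (measurableT_comp (f := fun x : R => (x `^ q)%R)) measurable_slice_norm.
exact: measurable_powR.
Qed.

Let time_norm_pow_le t : time_norm_pow t <= (L `^ q * pi * k t `^ q)%:E.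
Proof.
apply: (@le_trans _ _ (\int[mu]_s ((L `^ q * k t `^ q)%R%:E * (k s)%:E))).
  apply: ge0_le_integral_nomeas => s _ //.
  rewrite -EFinM lee_fin.
  apply: (@le_trans _ _ ((L * (k t * k s)) `^ q)%R).
    by apply: ge0_ler_powR; rewrite ?nnegrE ?sqrtr_ge0 ?(ltW q0)// !mulr_ge0 ?sqrtr_ge0.
  rewrite !powRM ?mulr_ge0 ?sqrtr_ge0// mulrA ler_wpM2l ?mulr_ge0 ?powR_ge0//.
  have ks0 : (0 < k s)%R by rewrite invr_gt0 (lt_le_trans ltr01)// oneDsqr_ge1.
  (* Since [0 < k s <= 1] and [1 <= q], the power [k s ^ q] stays below the integrable [k s]. *)
  rewrite ge1r_powR ?ks0 ?k1//.
  by case/andP: q12.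
rewrite ge0_integralZl_real//; last 2 first.
- by rewrite mulr_ge0 ?powR_ge0.
- exact/measurable_EFinP.
by rewrite ik -EFinM lee_fin mulrAC.
Qed.

Lemma time_norm_powE t : time_norm_pow t = (time_norm t `^ q)%:E.
Proof.
have fin : time_norm_pow t \is a fin_num.
  rewrite ge0_fin_numE; first exact: le_lt_trans (time_norm_pow_le t) (ltry _).
  by apply: integral_ge0.
rewrite /time_norm -powRrM mulVf ?gt_eqF// powRr1 ?fineK//.
by rewrite fine_ge0// integral_ge0.
Qed.

Lemma measurable_time_norm : measurable_fun setT time_norm.
Proof.
apply: (measurableT_comp (f := fun x : R => (x `^ q^-1)%R)).
  exact: measurable_powR.
apply: (measurableT_comp (f := @fine R)); first exact: fine_measurable.
exact: (measurable_fun_fubini_tonelli_F (m2 := mu) _ mpowq).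
Qed.

Lemma time_norm_ge0 t : (0 <= time_norm t)%R.
Proof. exact: powR_ge0. Qed.

Lemma mixed_normE : mixed_norm q f = \int[mu]_t (time_norm t)%:E.
Proof.
rewrite /mixed_norm; apply: eq_integral => t _.
rewrite /time_norm -poweR_EFin fineK; last first.
  by rewrite time_norm_powE.
congr (_ `^ _); apply: eq_integral => s _.
rewrite -/(slice_norm2 t s) slice_norm2E poweR_EFin; congr EFin.
rewrite -powR_mulrn ?sqrtr_ge0// -powRrM; congr (_ `^ _)%R.
by field.
Qed.

(** Finiteness lets the mixed norm be perturbed by a small positive real and the perturbation be
    sent to zero. *)
Lemma mixed_norm_fin_num : mixed_norm q f \is a fin_num.
Proof.
rewrite mixed_normE ge0_fin_numE; last first.
  by apply: integral_ge0 => t _; rewrite lee_fin time_norm_ge0.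
pose c := ((L `^ q * pi) `^ q^-1)%R.
apply: (@le_lt_trans _ _ (\int[mu]_t (c%:E * (k t)%:E))).
  apply: ge0_le_integral_nomeas => t _; first by rewrite lee_fin time_norm_ge0.
  rewrite -EFinM lee_fin.
  have := time_norm_pow_le t; rewrite time_norm_powE lee_fin => h.
  have qi : (0 <= q^-1)%R by rewrite invr_ge0 ltW.
  rewrite /c -[leLHS](powRr1 (time_norm_ge0 t)) -[in leLHS](mulfV (lt0r_neq0 q0)) powRrM.
  apply: le_trans (ge0_ler_powR qi _ _ h) _; rewrite ?nnegrE ?mulr_ge0 ?powR_ge0 ?pi_ge0//.
  by rewrite powRM ?mulr_ge0 ?powR_ge0 ?pi_ge0// -powRrM mulfV ?lt0r_neq0// powRr1.
rewrite ge0_integralZl_real ?powR_ge0//; last exact/measurable_EFinP.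
by rewrite ik -EFinM ltry.
Qed.
End mixed_norm_majorant.

Lemma smooth1_continuous {R : realType} (psi : R -> R) : smooth1 psi -> continuous psi.
Proof.
by move=> sm x; apply: differentiable_continuous; apply/derivable1_diffP; exact: (sm 0%N x).
Qed.

Lemma sigma_loc_integral_ge0 {R : realType} (psi : R -> R) (F : nat * R * R -> R[i]) :
  (forall x, 0 <= psi x) -> (0 <= sigma_loc_integral psi (fun p => ((cmod (F p)) ^+ 2)%:E))%E.
Proof.
move=> psi0; apply: nneseries_ge0 => alpha _ _; apply: integral_ge0 => l _.
by rewrite mule_ge0 ?lee_fin ?sqr_ge0.
Qed.

Theorem proposition7p1 (R : realType) (psi : R -> R)
    (psi_ge0 : forall x, 0 <= psi x)
    (psi_smooth : smooth1 psi)
    (psi_even : forall x, psi (- x) = psi x)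
    (psi_compact : compact (closure [set x | psi x != 0]))
    (psi_le1 : ('N[@lebesgue_measure R]_(+oo)[EFin \o psi] <= 1)%E)
    (q : R) (q_ge1 : 1 <= q) (q_le2 : q <= 2) :
  exists C : R, forall f : R * R * R -> R[i], schwartz f ->
    (L2_sigma_loc_norm psi (restriction_op f) <= C%:E * mixed_norm q f)%E.
Proof.
have cpsi := smooth1_continuous psi_smooth.
have mpsi : measurable_fun setT psi by exact: continuous_measurable_fun.
have [M [Bpsi [M0 Bpsi0 psi_le]]] := compact_support_parabola_bound cpsi psi_compact.
have p0 := pi_ge0 R.
have q12 : 1 <= q <= 2 by rewrite q_ge1.
set A := 78 * (8 * Bpsi * (4 * M ^+ 3 + 8 * M + 8) * (1 + pi + pi)).
have A0 : 0 <= A.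
  have e1 : 0 <= 4 * M ^+ 3 + 8 * M + 8 by have := exprn_ge0 3 M0; lra.
  have e2 : 0 <= 1 + pi + pi :> R by lra.
  by rewrite /A mulr_ge0// mulr_ge0// mulr_ge0// mulr_ge0.
(* [A] depends on [psi] alone, through [M] and [Bpsi]: the Schwartz bounds of [f] only justify
   convergence, and the constant is the same for every [q] in [[1, 2]]. *)
exists (Num.sqrt A) => f [sf1 sf2].
have [B1 B10 hB1] := schwartz_real_bound sf1.
have [B2 B20 hB2] := schwartz_real_bound sf2.
have mg1 := schwartz_real_measurable sf1.
have mg2 := schwartz_real_measurable sf2.
pose B := B1 + B2.
have B0 : 0 <= B by rewrite addr_ge0.
have k0 (x : R) : 0 <= (oneDsqr x)^-1 by rewrite invr_ge0.
have k1 (x : R) : (oneDsqr x)^-1 <= 1 by exact: oneDsqrV_le1.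
have kgt0 (x : R) : 0 < (oneDsqr x)^-1.
  by rewrite invr_gt0 (lt_le_trans ltr01)// oneDsqr_ge1.
have weaken (b y : R) (x t s : R) : 0 <= b -> b <= B ->
    y <= b * (oneDsqr x)^-1 * (oneDsqr t)^-1 * (oneDsqr s)^-1 ->
    y <= B * (oneDsqr x)^-1 * (oneDsqr t)^-1 * (oneDsqr s)^-1.
  by move=> b0 bB /le_trans; apply; rewrite !ler_wpM2r.
have drop (y : R) (x t s : R) :
    y <= B * (oneDsqr x)^-1 * (oneDsqr t)^-1 * (oneDsqr s)^-1 -> y <= B * (oneDsqr s)^-1.
  move=> /le_trans; apply; rewrite ler_wpM2r// -mulrA ler_piMr//.
  by rewrite mulr_ile1.
have B1B : B1 <= B by rewrite lerDl.
have B2B : B2 <= B by rewrite lerDr.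
have hg1 x t s := weaken B1 _ x t s B10 B1B (hB1 x t s).
have hg2 x t s := weaken B2 _ x t s B20 B2B (hB2 x t s).
have mn_fin := mixed_norm_fin_num B0 q12 hg1 hg2.
have mnE := mixed_normE B0 q12 hg1 hg2.
have sig (N : R) (e : R) : 0 < e -> N = fine (mixed_norm q f) + e * pi ->
    (L2_sigma_loc_norm psi (restriction_op f) <= (Num.sqrt A * N)%:E)%E.
  move=> e0 NE.
  have N0 : 0 < N.
    rewrite NE ltr_wpDl ?mulr_gt0 ?pi_gt0// fine_ge0// mnE.
    by apply: integral_ge0 => t _; rewrite lee_fin time_norm_ge0.
  (* The norm at time [t] may vanish while the weighted Cauchy-Schwarz divides by [n t]; the added
     term is positive and has total mass [e * pi]. *)
  pose n t := time_norm f q t + e * (oneDsqr t)^-1.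
  have n0 t : 0 < n t by rewrite ltr_wpDl ?time_norm_ge0// mulr_gt0.
  have mk : measurable_fun setT (fun t : R => (oneDsqr t)^-1).
    by apply: continuous_measurable_fun; exact: continuous_oneDsqrV.
  have mn : measurable_fun setT n.
    apply: measurable_funD; first exact: measurable_time_norm.
    exact: measurable_funM.
  have an t : (\int[@lebesgue_measure R]_s ((slice_norm f t s `^ q)%R)%:E <= (n t `^ q)%:E)%E.
    have := time_norm_powE B0 q12 hg1 hg2 t; rewrite /time_norm_pow => ->.
    rewrite lee_fin ge0_ler_powR ?nnegrE ?time_norm_ge0 ?(ltW (n0 t))//; first lra.
    by rewrite lerDl mulr_ge0// ltW.
  have nN : (\int[@lebesgue_measure R]_t (n t)%:E <= N%:E)%E.
    have -> : (N%:E = mixed_norm q f + e%:E * pi%:E)%E by rewrite NE EFinD EFinM fineK.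
    rewrite mnE -integral_oneDsqrV -ge0_integralZl_real ?(ltW e0)//; last first.
      exact/measurable_EFinP.
    rewrite -ge0_integralDT//.
    - by apply/measurable_EFinP; exact: measurable_time_norm.
    - by apply/measurable_EFinP; exact: measurable_funM.
    - by move=> t; rewrite lee_fin time_norm_ge0.
    - by move=> t; rewrite -EFinM lee_fin mulr_ge0// ltW.
  have a0 t s : 0 <= slice_norm f t s by exact: sqrtr_ge0.
  have ma t : measurable_fun setT (slice_norm f t).
    exact: (measurable_fun_pair2 t (measurable_slice_norm mg1 mg2)).
  have := sigma_loc_integral_le mg1 mg2 (fun x t s => drop _ x t s (hg1 x t s))
    (fun x t s => drop _ x t s (hg2 x t s)) psi_ge0 mpsi psi_even M0 Bpsi0 psi_le q12
    a0 ma (slice_norm_Re B0 hg1 hg2) (slice_norm_Im B0 hg1 hg2)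
    n0 mn an N0 nN.
  have := sigma_loc_integral_ge0 (restriction_op f) psi_ge0.
  rewrite -/A /L2_sigma_loc_norm; move: (sigma_loc_integral _ _) => S S0 hS.
  have AN : 0 <= A * N ^+ 2 by rewrite mulr_ge0// sqr_ge0.
  have -> : ((Num.sqrt A * N)%:E = (A * N ^+ 2)%:E `^ 2^-1)%E.
    by rewrite poweR_EFin powR12_sqrt// (sqrtrM (N ^+ 2) A0) sqrtr_sqr gtr0_norm.
  by apply: gt0_ler_poweR; rewrite ?in_itv/= ?lee_fin ?leey ?andbT ?invr_ge0.
have mnf0 : 0 <= fine (mixed_norm q f).
  by rewrite fine_ge0// mnE; apply: integral_ge0 => t _; rewrite lee_fin time_norm_ge0.
rewrite -(fineK mn_fin) -EFinM; apply/lee_addgt0Pr => d d0.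
have sA0 : 0 <= Num.sqrt A := sqrtr_ge0 _.
have D0 : 0 < Num.sqrt A * pi + 1 by rewrite ltr_wpDl// mulr_ge0.
(* This [e] makes the excess [sqrt A * e * pi] at most [d]; the [+ 1] keeps the denominator positive
   when [A] is zero. *)
apply: le_trans (sig _ (d / (Num.sqrt A * pi + 1)) (divr_gt0 d0 D0) erefl) _.
rewrite -EFinD lee_fin mulrDr lerD2l.
rewrite [leLHS](_ : _ = d * (Num.sqrt A * pi / (Num.sqrt A * pi + 1))); last by ring.
by rewrite ler_piMr ?(ltW d0)// ler_pdivrMr// mul1r lerDl.
Qed.
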